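(* Let $\Bbbk$ be an algebraically closed field of characteristic $0$ and let $L$ be an affine Kac-Moody algebra over $\Bbbk$ (untwisted or twisted), with central element $c$ and derived subalgebra $L'$. (1) For any $\lambda\in\Bbbk^*$, the algebras $S_\lambda(L)=S(L)/(c-\lambda)$ and $S_\lambda(L')=S(L')/(c-\lambda)$ are Poisson simple. (2) Any nonzero Poisson ideal of $S(L)$ or of $S(L')$ contains a nonzero element of $\Bbbk[c]$; equivalently, $S(L)\otimes_{\Bbbk[c]}\Bbbk(c)$ and $S(L')\otimes_{\Bbbk[c]}\Bbbk(c)$ are Poisson simple.
   Context: An affine Kac-Moody algebra $L$ is realised as follows. There are a finite-dimensional simple Lie algebra $\mathfrak g$ and an automorphism $\sigma$ of $\mathfrak g$ of order $r$ induced by a Dynkin diagram automorphism ($\sigma=\mathrm{id}$ in the untwisted case). With $\eta$ a primitive $r$-th root of unity and $\mathfrak g_{\overline s}=\{g\in\mathfrak g:\sigma(g)=\eta^sg\}$, the (twisted) loop algebra is $\mathfrak g[t,t^{-1}]^\sigma=\bigoplus_{s\in\mathbb Z}\mathfrak g_{\overline s}t^s$. Then $L=\mathfrak g[t,t^{-1}]^\sigma\oplus\Bbbk c\oplus\Bbbk d$ with $c$ central, $[d,xt^a]=a\,xt^a$, $[xt^a,yt^b]=[x,y]t^{a+b}+a\,\delta_{a+b,0}\,\kappa(x,y)\,c$, where $\kappa$ is the Killing form (up to nonzero scalar); $L'=\mathfrak g[t,t^{-1}]^\sigma\oplus\Bbbk c$. The symmetric algebra $S(\mathfrak k)$ of a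 Lie algebra $\mathfrak k$ has the Kostant-Kirillov Poisson bracket determined by $\{x,y\}=[x,y]$ for $x,y\in\mathfrak k$; it descends to $S_\lambda(L)$, $S_\lambda(L')$ since $c-\lambda$ is Poisson central, and extends $\Bbbk(c)$-bilinearly to the localisations, where $\Bbbk(c)$ is the fraction field of $\Bbbk[c]$. A Poisson ideal is an ideal which is also a Lie ideal for the Poisson bracket. A Poisson algebra is Poisson simple if its only Poisson ideals are $0$ and the whole algebra. *)

(* Defs.v *)
From HB Require Import structures.
From mathcomp Require Import all_boot all_order all_fingroup all_algebra.
From mathcomp Require Import boolp classical_sets functions cardinality fsbigop.

Set Implicit Arguments.
Unset Strict Implicit.
Unset Printing Implicit Defensive.

Import Order.TTheory GRing.Theory Num.Theory passmx.
Local Open Scope classical_set_scope.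
Local Open Scope ring_scope.

HB.mixin Record Lmodule_isLie (k : fieldType) L of GRing.Lmodule k L := {
  lie : L -> L -> L;
  lie_linearl : forall y, linear (lie^~ y);
  lie_linearr : forall x, linear (lie x);
  liexx : forall x, lie x x = 0;
  lie_jacobi : forall x y z,
    lie x (lie y z) + lie y (lie z x) + lie z (lie x y) = 0
}.

#[short(type="lieAlgType")]
HB.structure Definition Lie (k : fieldType) :=
  {L of Lmodule_isLie k L & GRing.Lmodule k L}.

#[short(type="finLieAlgType")]
HB.structure Definition FinLie (k : fieldType) :=
  {L of Lmodule_isLie k L & Vector k L}.

HB.mixin Record Lie_isPoisson (k : fieldType) S
    of Lie k S & GRing.ComAlgebra k S := {
  lie_leibniz : forall a b c : S, lie a (b * c) = lie a b * c + b * lie a c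
}.

#[short(type="poissonAlgType")]
HB.structure Definition Poisson (k : fieldType) :=
  {S of Lie_isPoisson k S & Lie k S & GRing.ComAlgebra k S}.

Section LieTheory.
Variables (k : fieldType) (L : lieAlgType k).
Implicit Types x y z : L.

HB.instance Definition _ x :=
  GRing.isSemilinear.Build k L L _ (lie x)
    (GRing.semilinear_linear (@lie_linearr k L x)).

Lemma lieDl x y z : lie (x + y) z = lie x z + lie y z.
Proof. by have := lie_linearl z 1 x y; rewrite !scale1r. Qed.
Lemma lieDr x y z : lie x (y + z) = lie x y + lie x z.
Proof. exact: linearD. Qed.
Lemma lie0l x : lie 0 x = 0.
Proof. by have /(congr1 (+%R^~ (- lie 0 x))) := lieDl 0 0 x; rewrite addr0 addrK subrr. Qed.
Lemma lie0r x : lie x 0 = 0.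
Proof. exact: linear0. Qed.
Lemma lieZl a x z : lie (a *: x) z = a *: lie x z.
Proof. by have := lie_linearl z a x 0; rewrite !addr0 lie0l addr0. Qed.
Lemma lieZr a x z : lie x (a *: z) = a *: lie x z.
Proof. exact: linearZ. Qed.
Lemma lieC x y : lie x y = - lie y x.
Proof.
apply/eqP; rewrite -addr_eq0; apply/eqP.
by have := liexx (x + y); rewrite lieDl !lieDr !liexx add0r addr0.
Qed.

End LieTheory.

Section FinLieTheory.
Variables (k : fieldType) (g : finLieAlgType k).
Implicit Types x y z : g.

Definition simple_Lie : Prop :=
  (exists x, exists y, lie x y != 0) /\
  (forall U : {vspace g},
     (forall x u, u \in U -> lie x u \in U) -> U = 0%VS \/ U = fullv).

Definition ad x : 'End(g) := linfun (lie x).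

Definition killing x y : k :=
  \tr (mxof (vbasis fullv) (vbasis fullv) (ad x \o ad y)%VF).

(* [A i j] is the value of the j-th simple root on the i-th simple coroot. *)
Record chevalley_generators n (A : 'M[int]_n) (e f h : 'I_n -> g) : Prop := {
  cartan_diag : forall i, A i i = 2;
  cartan_off : forall i j, i != j -> A i j <= 0;
  cartan_sym0 : forall i j, A i j = 0 -> A j i = 0;
  chevalley_free : free [seq h i | i <- enum 'I_n];
  chevalley_hh : forall i j, lie (h i) (h j) = 0;
  chevalley_ef : forall i j, lie (e i) (f j) = if i == j then h i else 0;
  chevalley_he : forall i j, lie (h i) (e j) = e j *~ A i j;
  chevalley_hf : forall i j, lie (h i) (f j) = - (f j *~ A i j);
  chevalley_gen : forall U : {vspace g},
    (forall u v, u \in U -> v \in U -> lie u v \in U) ->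
    (forall i, (e i \in U) && (f i \in U)) -> U = fullv
}.

Definition Lie_endomorphism (s : {linear g -> g}) : Prop :=
  forall x y, s (lie x y) = lie (s x) (s y).

(* Bijectivity follows, since a power of [s] is the identity. *)
Definition diagram_automorphism (s : {linear g -> g}) : Prop :=
  Lie_endomorphism s /\
  exists n (A : 'M[int]_n) (e f h : 'I_n -> g) (p : 'S_n),
    [/\ chevalley_generators A e f h,
        forall i j, A (p i) (p j) = A i j,
        forall i, s (e i) = e (p i),
        forall i, s (f i) = f (p i)
      & forall i, s (h i) = h (p i)].

Definition has_order (s : g -> g) (r : nat) : Prop :=
  [/\ (0 < r)%N, iter r s =1 id
    & forall m, (0 < m < r)%N -> ~ iter m s =1 id].

End FinLieTheory.

(* A Lie subalgebra of a possibly infinite-dimensional Lie algebra, and the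
   corresponding type. *)
Record lieSubalgebra (k : fieldType) (L : lieAlgType k) := LieSubalgebra {
  lie_sub_mem :> {pred L};
  lie_sub_submod : submod_closed lie_sub_mem;
  lie_sub_lie : forall x y,
    x \in lie_sub_mem -> y \in lie_sub_mem -> lie x y \in lie_sub_mem
}.

Section LieSub.
Variables (k : fieldType) (L : lieAlgType k) (W : lieSubalgebra L).

HB.instance Definition _ :=
  GRing.isSubmodClosed.Build k L (lie_sub_mem W)
    (GRing.submod_closed_semi (lie_sub_submod W)).

Record lie_sub := LieSub { lie_sub_val :> L; _ : lie_sub_val \in W }.
HB.instance Definition _ := [isSub for lie_sub_val].
HB.instance Definition _ := [Choice of lie_sub by <:].
HB.instance Definition _ := [SubChoice_isSubLmodule of lie_sub by <:].


Lemma lie_sub_valD x y : lie_sub_val (x + y) = lie_sub_val x + lie_sub_val y.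
Proof. by []. Qed.
Lemma lie_sub_valZ a x : lie_sub_val (a *: x) = a *: lie_sub_val x.
Proof. by []. Qed.

Definition lie_sub_lie_def (x y : lie_sub) : lie_sub :=
  LieSub (lie_sub_lie (valP x) (valP y)).

Fact lie_sub_linearl y : linear (lie_sub_lie_def^~ y).
Proof. by move=> a u v; apply: val_inj; rewrite /= lieDl lieZl. Qed.
Fact lie_sub_linearr x : linear (lie_sub_lie_def x).
Proof. by move=> a u v; apply: val_inj; rewrite /= lieDr lieZr. Qed.
Fact lie_sub_liexx x : lie_sub_lie_def x x = 0.
Proof. by apply: val_inj; rewrite /= liexx. Qed.
Fact lie_sub_jacobi x y z :
  lie_sub_lie_def x (lie_sub_lie_def y z) +
  lie_sub_lie_def y (lie_sub_lie_def z x) +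
  lie_sub_lie_def z (lie_sub_lie_def x y) = 0.
Proof. by apply: val_inj; rewrite /= lie_jacobi. Qed.
HB.instance Definition _ := Lmodule_isLie.Build k lie_sub
  lie_sub_linearl lie_sub_linearr lie_sub_liexx lie_sub_jacobi.

End LieSub.

Section Killing.
Variables (k : fieldType) (g : finLieAlgType k).
Implicit Types x y z : g.

Lemma ad_linear : linear (@ad k g).
Proof.
by move=> a x y; apply/lfunP => z; do !rewrite lfunE /=; rewrite lieDl lieZl.
Qed.

Lemma killingC x y : killing x y = killing y x.
Proof. by rewrite /killing !(mxof_comp _ _ (vbasisP _)) mxtrace_mulC. Qed.

Lemma killing_linearl y : linear_for *%R (@killing k g ^~ y).
Proof.
by move=> a u v; rewrite /killing ad_linear comp_lfunDl -comp_lfunZl linearP mxtraceD mxtraceZ.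
Qed.

Lemma killing_linearr x : linear_for *%R (@killing k g x).
Proof. by move=> a u v; rewrite ![killing x _]killingC killing_linearl. Qed.

Lemma ad_lie x y : ad (lie x y) = ((ad x \o ad y) - (ad y \o ad x))%VF.
Proof.
apply/lfunP => z; do !rewrite lfunE /=.
have := lie_jacobi x y z; rewrite (lieC z x) linearN /= (lieC z (lie x y)).
by move/eqP; rewrite subr_eq0 => /eqP.
Qed.

Lemma killing_lie x y z : killing (lie x y) z = killing x (lie y z).
Proof.
rewrite /killing !ad_lie comp_lfunDl comp_lfunDr comp_lfunNl comp_lfunNr.
rewrite !linearB /= !comp_lfunA; congr (_ - _).
rewrite -[in LHS]comp_lfunA !(mxof_comp _ _ (vbasisP _)) mxtrace_mulC.
by rewrite mulmxA.
Qed.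

End Killing.

(* Laurent polynomials with coefficients in [g]: [f : laurent g] is the sum
   of the [f s] t^s. *)
Section Laurent.
Variables (k : fieldType) (g : lmodType k).

Definition finite_supp (f : int -> g) : Prop :=
  finite_set [set s | f s != 0].

Lemma finite_suppP f :
  finite_supp f <->
  exists2 r : seq int, uniq r & forall s, s \notin r -> f s = 0.
Proof.
split=> [/finite_seqP[r fr]|[r _ fr]].
  exists (undup r) => [|s]; first exact: undup_uniq.
  rewrite mem_undup => /negP sr; apply/eqP/negPn/negP => fs.
  by apply: sr; have : [set s | f s != 0] s by []; rewrite fr.
apply: (@sub_finite_set _ _ [set` r]); last exact: finite_seq.
by move=> s /= /negP fs; apply/negPn/negP => /fr/eqP.
Qed.

Definition laurent_pred := [pred f : int -> g | `[< finite_supp f >]].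

Lemma laurent_predP f : reflect (finite_supp f) (f \in laurent_pred).
Proof. exact: asboolP. Qed.

Fact laurent_submod : submod_closed laurent_pred.
Proof.
split=> [|a f h]; first by apply/laurent_predP/finite_suppP; exists [::].
move=> /laurent_predP/finite_suppP[r _ fr] /laurent_predP/finite_suppP[q _ hq].
apply/laurent_predP/finite_suppP; exists (undup (r ++ q)) => [|s].
  exact: undup_uniq.
rewrite mem_undup mem_cat negb_or => /andP[/fr fs /hq hs].
by rewrite /= /GRing.add /= /GRing.scale /= fs hs scaler0 addr0.
Qed.
HB.instance Definition _ := GRing.isSubmodClosed.Build k (int -> g) laurent_pred
  (GRing.submod_closed_semi laurent_submod).

Record laurent :=
  Laurent { laurent_coef :> int -> g; _ : laurent_coef \in laurent_pred }.
HB.instance Definition _ := [isSub for laurent_coef].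
HB.instance Definition _ := [Choice of laurent by <:].
HB.instance Definition _ := [SubChoice_isSubLmodule of laurent by <:].

Implicit Types f h : laurent.

Lemma laurentP f h : f =1 h <-> f = h.
Proof. by split=> [fh|->//]; apply/val_inj/funext. Qed.

Lemma laurentD f h s : (f + h) s = f s + h s. Proof. by []. Qed.
Lemma laurentZ a f s : (a *: f) s = a *: f s. Proof. by []. Qed.
Lemma laurentN f s : (- f) s = - f s. Proof. by []. Qed.
Lemma laurent0 s : (0 : laurent) s = 0. Proof. by []. Qed.
Definition laurentE := (laurentD, laurentZ, laurentN, laurent0).

Lemma laurent_supp f :
  exists2 r : seq int, uniq r & forall s, s \notin r -> f s = 0.
Proof. exact/finite_suppP/laurent_predP/(valP f). Qed.

Lemma laurent_supp2 f h : exists r : seq int,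
  [/\ uniq r, forall s, s \notin r -> f s = 0 & forall s, s \notin r -> h s = 0].
Proof.
have [[r _ fr] [q _ hq]] := (laurent_supp f, laurent_supp h).
exists (undup (r ++ q)); split=> [|s|s]; first exact: undup_uniq.
  by rewrite mem_undup mem_cat negb_or => /andP[/fr].
by rewrite mem_undup mem_cat negb_or => /andP[_ /hq].
Qed.

(* The monomial [x] t^[a]. *)
Fact monomial_subproof (a : int) (x : g) :
  (fun s => if s == a then x else 0) \in laurent_pred.
Proof.
apply/laurent_predP/finite_suppP; exists [:: a] => // s.
by rewrite inE => /negPf ->.
Qed.
Definition monomial a x := Laurent (monomial_subproof a x).

Lemma monomialE a x s : monomial a x s = if s == a then x else 0.
Proof. by []. Qed.

Lemma laurent_ind (P : laurent -> Prop) :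
  P 0 -> (forall a x f, P f -> P (monomial a x + f)) -> forall f, P f.
Proof.
move=> P0 PD f; have [r] := laurent_supp f.
elim: r => [|a r IHr] in f * => /= [_|/andP[ar ur]] fr.
  by rewrite (_ : f = 0) //; apply/laurentP => s; rewrite fr.
rewrite -(subrK (monomial a (f a)) f) addrC; apply/PD/IHr => // s sr.
rewrite !laurentE monomialE; case: eqP => [->|/eqP sa]; first exact: subrr.
by rewrite fr ?subr0// inE negb_or sa.
Qed.

End Laurent.

Lemma fsumTE (V : zmodType) (r : seq int) (F : int -> V) : uniq r ->
  (forall s, s \notin r -> F s = 0) ->
  \sum_(s \in [set: int]) F s = \sum_(s <- r) F s.
Proof.
move=> ur Fr; rewrite (fsbig_seq _ _ ur); apply/esym/(fsbig_widen [set` r]) => // s [_ /=].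
by move=> /negP /Fr.
Qed.

Section Loop.
Variables (k : fieldType) (g : finLieAlgType k).
Implicit Types (f h : laurent g) (x y : g).

Fact loop_lie_subproof f h :
  (fun n => \sum_(a \in [set: int]) lie (f a) (h (n - a))) \in laurent_pred g.
Proof.
have [[r ur fr] [q uq hq]] := (laurent_supp f, laurent_supp h).
apply/laurent_predP/finite_suppP.
exists (undup [seq a + b | a <- r, b <- q]) => [|n]; first exact: undup_uniq.
rewrite mem_undup => nrq; rewrite fsbig1// => a _.
have [ar|/fr ->] := boolP (a \in r); last by rewrite lie0l.
rewrite hq ?lie0r//; apply: contra nrq => naq.
by apply/allpairsP; exists (a, n - a); split=> //=; rewrite addrC subrK.
Qed.
(* The bracket of g[t, t^-1]. *)
Definition loop_lie f h : laurent g := Laurent (loop_lie_subproof f h).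

Fact loop_deriv_subproof f : (fun n => f n *~ n) \in laurent_pred g.
Proof.
have [r ur fr] := laurent_supp f.
by apply/laurent_predP/finite_suppP; exists r => // s /fr ->; rewrite mul0rz.
Qed.
(* The derivation t d/dt. *)
Definition loop_deriv f : laurent g := Laurent (loop_deriv_subproof f).

(* The cocycle, with [nu] times the Killing form as invariant form. *)
Definition loop_cocycle (nu : k) f h : k :=
  \sum_(a \in [set: int]) (nu * killing (f a) (h (- a))) *~ a.

Lemma loop_lieE r f h n : uniq r -> (forall s, s \notin r -> f s = 0) ->
  loop_lie f h n = \sum_(a <- r) lie (f a) (h (n - a)).
Proof. by move=> ur fr; apply: fsumTE => // s /fr ->; rewrite lie0l. Qed.

Lemma killing0l x : killing 0 x = 0.
Proof. by have := killing_linearl x (-1) 0 0; rewrite scaler0 addr0 mulN1r addNr. Qed.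

Lemma loop_cocycleE r nu f h : uniq r -> (forall s, s \notin r -> f s = 0) ->
  loop_cocycle nu f h = \sum_(a <- r) (nu * killing (f a) (h (- a))) *~ a.
Proof.
by move=> ur fr; apply: fsumTE => // s /fr ->; rewrite killing0l mulr0 mul0rz.
Qed.

Lemma loop_lie_linearl h : linear (loop_lie^~ h).
Proof.
move=> a f f'; apply/laurentP => n; rewrite !laurentE.
have [r [ur fr f'r]] := laurent_supp2 f f'.
rewrite !(@loop_lieE r)//; last first.
  by move=> s sr; rewrite !laurentE fr ?f'r// scaler0 addr0.
rewrite scaler_sumr -big_split /=; apply: eq_bigr => b _.
by rewrite lieDl lieZl.
Qed.

Lemma loop_lie_linearr f : linear (loop_lie f).
Proof.
move=> a h h'; apply/laurentP => n; rewrite !laurentE.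
have [r ur fr] := laurent_supp f; rewrite !(@loop_lieE r)//.
rewrite scaler_sumr -big_split /=; apply: eq_bigr => b _.
by rewrite lieDr lieZr.
Qed.

Lemma loop_lie_monomial a b x y :
  loop_lie (monomial a x) (monomial b y) = monomial (a + b) (lie x y).
Proof.
apply/laurentP => n; rewrite (@loop_lieE [:: a])//; last first.
  by move=> s; rewrite inE monomialE => /negPf ->.
rewrite big_seq1 !monomialE eqxx subr_eq [b + a]addrC.
by case: eqP; rewrite ?lie0r.
Qed.

Lemma loop_cocycle_linearl nu h : linear_for *%R (loop_cocycle nu ^~ h).
Proof.
move=> a f f'; have [r [ur fr f'r]] := laurent_supp2 f f'.
rewrite !(@loop_cocycleE r)//; last first.
  by move=> s sr; rewrite !laurentE fr ?f'r// scaler0 addr0.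
rewrite mulr_sumr -big_split /=; apply: eq_bigr => b _.
by rewrite killing_linearl mulrDr mulrzDl mulrCA mulrzAr.
Qed.

Lemma loop_cocycle_linearr nu f : linear_for *%R (loop_cocycle nu f).
Proof.
move=> a h h'; have [r ur fr] := laurent_supp f; rewrite !(@loop_cocycleE r)//.
rewrite mulr_sumr -big_split /=; apply: eq_bigr => b _.
by rewrite killing_linearr mulrDr mulrzDl mulrCA mulrzAr.
Qed.

Lemma loop_cocycle_monomial nu a b x y :
  loop_cocycle nu (monomial a x) (monomial b y) =
  if a + b == 0 then (nu * killing x y) *~ a else 0.
Proof.
rewrite (@loop_cocycleE [:: a])//; last first.
  by move=> s; rewrite inE monomialE => /negPf ->.
rewrite big_seq1 !monomialE eqxx eq_sym -subr_eq0 opprK addrC.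
by case: eqP => // _; rewrite killingC killing0l mulr0 mul0rz.
Qed.

Lemma loop_deriv_linear : linear loop_deriv.
Proof.
move=> a f h; apply/laurentP => n.
by rewrite /= mulrzDl scalerMzr.
Qed.

Lemma loop_deriv_monomial a x : loop_deriv (monomial a x) = monomial a (x *~ a).
Proof.
by apply/laurentP => n; rewrite /=; case: eqP => [->|]; rewrite ?mul0rz.
Qed.

HB.instance Definition _ f := GRing.isSemilinear.Build k _ _ _ (loop_lie f)
  (GRing.semilinear_linear (loop_lie_linearr f)).
HB.instance Definition _ nu f := GRing.isSemilinear.Build k _ _ _
  (loop_cocycle nu f) (GRing.semilinear_linear (loop_cocycle_linearr nu f)).
HB.instance Definition _ := GRing.isSemilinear.Build k _ _ _ loop_deriv
  (GRing.semilinear_linear loop_deriv_linear).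

Lemma loop_lieDl f f' h : loop_lie (f + f') h = loop_lie f h + loop_lie f' h.
Proof. by rewrite -[f]scale1r loop_lie_linearl !scale1r. Qed.
Lemma loop_lie0l h : loop_lie 0 h = 0.
Proof. by apply: (addIr (loop_lie 0 h)); rewrite -loop_lieDl !add0r. Qed.
Lemma loop_cocycleDl nu f f' h :
  loop_cocycle nu (f + f') h = loop_cocycle nu f h + loop_cocycle nu f' h.
Proof. by rewrite -[f]scale1r loop_cocycle_linearl scale1r mul1r. Qed.
Lemma loop_cocycle0l nu h : loop_cocycle nu 0 h = 0.
Proof. by apply: (addIr (loop_cocycle nu 0 h)); rewrite -loop_cocycleDl !add0r. Qed.

Lemma loop_lieNC f h : loop_lie f h + loop_lie h f = 0.
Proof.
elim/laurent_ind: f => [|a x f IHf]; first by rewrite loop_lie0l linear0 addr0.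
rewrite loop_lieDl linearD /= addrACA IHf addr0.
elim/laurent_ind: h {f IHf} => [|b y h IHh].
  by rewrite loop_lie0l linear0 addr0.
rewrite loop_lieDl linearD /= addrACA IHh addr0 !loop_lie_monomial [b + a]addrC.
by apply/laurentP => n; rewrite !(laurentE, monomialE); case: ifP => _; rewrite ?addr0 // [lie x y]lieC addNr.
Qed.

Lemma loop_liexx f : loop_lie f f = 0.
Proof.
elim/laurent_ind: f => [|a x f IHf]; first by rewrite linear0.
rewrite loop_lieDl !linearD /= IHf addr0 -addrA loop_lieNC addr0.
by rewrite loop_lie_monomial liexx; apply/laurentP => n; rewrite !(laurentE, monomialE); case: ifP.
Qed.

Lemma loop_cocycleNC nu f h : loop_cocycle nu f h + loop_cocycle nu h f = 0.
Proof.
elim/laurent_ind: f => [|a x f IHf].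
  by rewrite loop_cocycle0l linear0 addr0.
rewrite loop_cocycleDl linearD /= addrACA IHf addr0.
elim/laurent_ind: h {f IHf} => [|b y h IHh].
  by rewrite loop_cocycle0l linear0 addr0.
rewrite loop_cocycleDl linearD /= addrACA IHh addr0 !loop_cocycle_monomial.
rewrite [b + a]addrC killingC; case: ifP => [|_]; last by rewrite addr0.
by rewrite addr_eq0 => /eqP ->; rewrite mulrNz addNr.
Qed.

Lemma loop_cocyclexx nu f : loop_cocycle nu f f = 0.
Proof.
elim/laurent_ind: f => [|a x f IHf]; first by rewrite linear0.
rewrite loop_cocycleDl !linearD /= IHf addr0 -addrA loop_cocycleNC addr0.
rewrite loop_cocycle_monomial; case: ifP => //.
by rewrite -mulr2n mulrn_eq0 /= => /eqP ->; rewrite mulr0z.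
Qed.

End Loop.

Section JacobiFromGenerators.
Variables (k : fieldType) (g : finLieAlgType k) (nu : k).
Variables (V : lmodType k) (br : V -> V -> V) (c d : V) (m : int -> g -> V).
Hypothesis br_linearr : forall u, linear (br u).
Hypothesis brxx : forall u, br u u = 0.
Hypothesis brC : forall u v, br u v = - br v u.
Hypothesis V_ind : forall P : V -> Prop,
  (forall a u v, P u -> P v -> P (a *: u + v)) -> P c -> P d ->
  (forall a x, P (m a x)) -> forall u, P u.
Hypothesis m_linear : forall a, linear (m a).
Hypothesis br_m : forall a b x y, br (m a x) (m b y) = m (a + b) (lie x y) +
  (if a + b == 0 then (nu * killing x y) *~ a else 0) *: c.
Hypothesis br_d : forall a x, br d (m a x) = m a (x *~ a).
Hypothesis br_c : forall u, br c u = 0.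

Let brL u : {linear V -> V} := HB.pack (br u)
  (GRing.isSemilinear.Build k V V _ (br u)
     (GRing.semilinear_linear (br_linearr u))).
Let mL a : {linear g -> V} := HB.pack (m a)
  (GRing.isSemilinear.Build k g V _ (m a)
     (GRing.semilinear_linear (m_linear a))).
Let br0 u : br u 0 = 0. Proof. exact: (linear0 (brL u)). Qed.
Let brD u v w : br u (v + w) = br u v + br u w.
Proof. exact: (linearD (brL u)). Qed.
Let brN u v : br u (- v) = - br u v. Proof. exact: (linearN (brL u)). Qed.
Let brZ u b v : br u (b *: v) = b *: br u v.
Proof. by rewrite -[b *: v]addr0 br_linearr br0 addr0. Qed.
Let brMz u v n : br u (v *~ n) = br u v *~ n. Proof. exact: (raddfMz (brL u)). Qed.
Let m0 a : m a 0 = 0. Proof. exact: (linear0 (mL a)). Qed.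
Let mD a x y : m a (x + y) = m a x + m a y. Proof. exact: (linearD (mL a)). Qed.
Let mMz a x n : m a (x *~ n) = m a x *~ n. Proof. exact: (raddfMz (mL a)). Qed.

Let J u v w := br u (br v w) + br v (br w u) + br w (br u v).

Fact jacobi_rot u v w : J u v w = J v w u.
Proof. by rewrite /J -addrA addrC. Qed.

Fact jacobi_linear v w a u u' : J (a *: u + u') v w = a *: J u v w + J u' v w.
Proof.
have brl x : br (a *: u + u') x = a *: br u x + br u' x.
  by rewrite ![br _ x]brC brD brZ opprD scalerN.
rewrite /J !brl !brD !brZ !scalerDr.
by rewrite (AC (2*2*2) ((1*3*5)*(2*4*6))).
Qed.

Fact jacobi_ind v w : J c v w = 0 -> J d v w = 0 ->
  (forall a x, J (m a x) v w = 0) -> forall u, J u v w = 0.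
Proof.
move=> Jc Jd Jm; apply: V_ind => // a u u' Ju Ju'.
by rewrite jacobi_linear Ju Ju' scaler0 addr0.
Qed.

Fact br_cr u : br u c = 0. Proof. by rewrite brC br_c oppr0. Qed.

Fact jacobi_c v w : J c v w = 0.
Proof. by rewrite /J !br_c br_cr !br0 !addr0. Qed.

Fact jacobi_dd w : J d d w = 0.
Proof. by rewrite /J brxx br0 addr0 [br w _]brC brN subrr. Qed.

Fact jacobi_dmm a b x y : J d (m a x) (m b y) = 0.
Proof.
rewrite /J [br _ d]brC !br_d !mMz !brN !brMz.
rewrite [br (m b y) _]brC mulNrz -addrA -opprD -mulrzDr br_m brD brZ.
rewrite br_cr scaler0 addr0 br_d mMz [b + a]addrC mulrzDl opprD addrA subrr.
rewrite sub0r; case: ifP => [/eqP ->|_]; first by rewrite mulr0z oppr0.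
by rewrite scale0r mul0rz oppr0.
Qed.

Fact jacobi_mmm a b e x y z : J (m a x) (m b y) (m e z) = 0.
Proof.
have br2 a' b' e' x' y' z' : br (m a' x') (br (m b' y') (m e' z')) =
    m (a' + (b' + e')) (lie x' (lie y' z')) +
    (if a' + (b' + e') == 0 then
       (nu * killing x' (lie y' z')) *~ a' else 0) *: c.
  by rewrite br_m brD brZ br_cr scaler0 addr0 br_m.
have E1 : b + (e + a) = a + (b + e) by rewrite addrA addrC.
have E2 : e + (a + b) = a + (b + e) by rewrite addrC -addrA.
rewrite /J !br2 E1 E2 (AC (2*2*2) ((1*3*5)*(2*4*6))) /= -!mD lie_jacobi m0 add0r.
rewrite -!scalerDl; case: ifP => [/eqP abe0|_]; last by rewrite !addr0 scale0r.
rewrite -(killing_lie x) (killingC _ z) (killingC y) (killing_lie z).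
by rewrite -!mulrzDr -addrA abe0 mulr0z scale0r.
Qed.

Lemma jacobi_from_generators u v w :
  br u (br v w) + br v (br w u) + br w (br u v) = 0.
Proof.
have Jd v' w' : J d v' w' = 0.
  rewrite jacobi_rot; move: v'; apply: jacobi_ind => [||a x].
  - exact: jacobi_c.
  - by rewrite -jacobi_rot jacobi_dd.
  rewrite jacobi_rot; move: w'; apply: jacobi_ind => [||b y].
  - exact: jacobi_c.
  - by rewrite jacobi_dd.
  by rewrite jacobi_rot jacobi_dmm.
have Jcr v' w' : J v' c w' = 0 by rewrite jacobi_rot jacobi_c.
rewrite -/(J u v w); move: u; apply: jacobi_ind => [||a x].
- exact: jacobi_c.
- exact: Jd.
rewrite jacobi_rot; move: v; apply: jacobi_ind => [||b y].
- exact: jacobi_c.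
- exact: Jd.
rewrite jacobi_rot; move: w; apply: jacobi_ind => [||e z].
- exact: jacobi_c.
- exact: Jd.
exact: jacobi_mmm.
Qed.

End JacobiFromGenerators.

(* The affinization [g[t, t^-1] (+) k c (+) k d] of [g], with respect to the
   invariant form [nu] times the Killing form; [(f, a, b)] is [f + a c + b d]. *)
Definition affinization (k : fieldType) (g : finLieAlgType k) (nu : k) : Type :=
  (laurent g * k^o * k^o)%type.

Section Affinization.
Variables (k : fieldType) (g : finLieAlgType k) (nu : k).
Local Notation hat := (affinization g nu).
HB.instance Definition _ := GRing.Lmodule.copy hat (laurent g * k^o * k^o)%type.
Implicit Types X Y Z : hat.

Definition loop_part X : laurent g := X.1.1.
Definition c_part X : k := X.1.2.
Definition d_part X : k := X.2.

Lemma loop_partP a X Y : loop_part (a *: X + Y) = a *: loop_part X + loop_part Y.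
Proof. by []. Qed.
Lemma d_partP a X Y : d_part (a *: X + Y) = a * d_part X + d_part Y.
Proof. by []. Qed.
Lemma c_partP a X Y : c_part (a *: X + Y) = a * c_part X + c_part Y.
Proof. by []. Qed.
Lemma affinizationP X Y : loop_part X = loop_part Y -> c_part X = c_part Y ->
  d_part X = d_part Y -> X = Y.
Proof. by case: X Y => [[f a] b] [[f' a'] b']; rewrite /loop_part /c_part /d_part /= => -> -> ->. Qed.

Definition affinization_lie X Y : hat :=
  (loop_lie (loop_part X) (loop_part Y) + d_part X *: loop_deriv (loop_part Y)
     - d_part Y *: loop_deriv (loop_part X),
   loop_cocycle nu (loop_part X) (loop_part Y), 0).
Local Notation br := affinization_lie.

Lemma loop_partN X : loop_part (- X) = - loop_part X.
Proof. by []. Qed.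
Lemma loop_part_lie X Y : loop_part (br X Y) =
  loop_lie (loop_part X) (loop_part Y) + d_part X *: loop_deriv (loop_part Y)
     - d_part Y *: loop_deriv (loop_part X).
Proof. by []. Qed.

Lemma affinization_liexx X : br X X = 0.
Proof. by rewrite /br loop_liexx loop_cocyclexx add0r subrr. Qed.

Lemma affinization_linearr X : linear (br X).
Proof.
move=> a Y Z; apply: affinizationP.
- rewrite loop_partP !loop_part_lie loop_partP d_partP !linearP /=.
  rewrite !scalerDl !scalerDr scalerN !scalerA.
  by rewrite opprD (AC (2*2*2) ((1*3*5)*(2*4*6))).
- exact: loop_cocycle_linearr.
- by rewrite d_partP /d_part /= mulr0 addr0.
Qed.

Lemma affinization_lieC X Y : br X Y = - br Y X.
Proof.
apply: affinizationP; rewrite /d_part /= ?oppr0 //.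
  rewrite loop_partN !loop_part_lie !opprD opprK.
  have /eqP := loop_lieNC (loop_part X) (loop_part Y).
  by rewrite addr_eq0 => /eqP ->; rewrite addrAC.
by apply/eqP; rewrite -addr_eq0; apply/eqP/loop_cocycleNC.
Qed.

HB.instance Definition _ X := GRing.isSemilinear.Build k hat hat _ (br X)
  (GRing.semilinear_linear (affinization_linearr X)).

Lemma affinization_linearl Y : linear (br^~ Y).
Proof.
move=> a X Z /=; rewrite ![br _ Y]affinization_lieC affinization_linearr.
by rewrite opprD scalerN.
Qed.

Definition loop_elt (f : laurent g) : hat := (f, 0, 0).
(* The element [x] t^[a]. *)
Definition loop_mono (a : int) (x : g) : hat := loop_elt (monomial a x).
Definition c_elt : hat := (0, 1, 0).
Definition d_elt : hat := (0, 0, 1).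

Lemma affinization_ind (P : hat -> Prop) :
  (forall a X Y, P X -> P Y -> P (a *: X + Y)) -> P c_elt -> P d_elt ->
  (forall a x, P (loop_mono a x)) -> forall X, P X.
Proof.
move=> PD Pc Pd Pm X.
have P0 : P 0 by have := PD (-1) _ _ Pc Pc; rewrite scaleN1r addNr.
have -> : X = c_part X *: c_elt + (d_part X *: d_elt + (1 *: loop_elt (loop_part X) + 0)).
  apply: affinizationP.
  - by rewrite !loop_partP !scaler0 !add0r scale1r addr0.
  - by rewrite !c_partP /c_part /= mulr1 !mulr0 !addr0.
  - by rewrite !d_partP /d_part /= !mulr0 mulr1 add0r !addr0.
apply/PD/PD/PD => //; elim/laurent_ind: (loop_part X) => [//|a x f IHf].
have -> : loop_elt (monomial a x + f) = 1 *: loop_mono a x + loop_elt f.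
  apply: affinizationP.
  - by rewrite loop_partP scale1r.
  - by rewrite c_partP mulr0 addr0.
  - by rewrite d_partP mulr0 addr0.
exact: PD.
Qed.

Lemma affinization_lie_monomial a b x y :
  br (loop_mono a x) (loop_mono b y) =
  loop_mono (a + b) (lie x y) +
  (if a + b == 0 then (nu * killing x y) *~ a else 0) *: c_elt.
Proof.
apply: affinizationP.
- rewrite loop_part_lie /loop_part /= loop_lie_monomial !scale0r subr0 addr0.
  by rewrite -[RHS]/(_ + _ *: 0) scaler0 addr0.
- rewrite /c_part /= loop_cocycle_monomial -[RHS]/(0 + _ * 1).
  by rewrite add0r mulr1.
- by rewrite /d_part /= -[RHS]/(0 + _ * 0) mulr0 addr0.
Qed.
Lemma affinization_lie_d a x : br d_elt (loop_mono a x) = loop_mono a (x *~ a).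
Proof.
apply: affinizationP; [|exact: loop_cocycle0l|by []].
rewrite loop_part_lie /loop_part /= /d_part /= loop_lie0l add0r scale1r scale0r.
by rewrite subr0 loop_deriv_monomial.
Qed.
Lemma affinization_lie_c X : br c_elt X = 0.
Proof.
apply: affinizationP; [|exact: loop_cocycle0l|by []].
rewrite loop_part_lie /loop_part /= /d_part /= loop_lie0l linear0.
by rewrite scale0r scaler0 addr0 subr0.
Qed.

Lemma loop_mono_linear a : linear (loop_mono a).
Proof.
move=> b x y; apply: affinizationP; last 2 first.
- by rewrite c_partP mulr0 addr0.
- by rewrite d_partP mulr0 addr0.
rewrite loop_partP; apply/laurentP => n.
rewrite !(laurentE, monomialE); case: ifP => //.
by rewrite scaler0 addr0.
Qed.

Lemma affinization_jacobi X Y Z :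
  br X (br Y Z) + br Y (br Z X) + br Z (br X Y) = 0.
Proof.
apply: (jacobi_from_generators (nu := nu) affinization_linearr affinization_liexx
  affinization_lieC affinization_ind loop_mono_linear affinization_lie_monomial
  affinization_lie_d affinization_lie_c).
Qed.

HB.instance Definition _ := Lmodule_isLie.Build k hat affinization_linearl
  affinization_linearr affinization_liexx affinization_jacobi.

End Affinization.

(* A finite-dimensional simple Lie algebra with a diagram automorphism, a
   primitive root of unity of the same order, and a scaling [aff_nu] of the
   Killing form. The untwisted case is [aff_sigma] = id, [aff_r] = 1. *)
Record affineDatum (k : fieldType) := AffineDatum {
  aff_g : finLieAlgType k;
  aff_simple : simple_Lie aff_g;
  aff_sigma : {linear aff_g -> aff_g};
  aff_diag : diagram_automorphism aff_sigma;
  aff_r : nat;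
  aff_order : has_order aff_sigma aff_r;
  aff_eta : k;
  aff_prim : aff_r.-primitive_root aff_eta;
  aff_nu : k;
  aff_nu_neq0 : aff_nu != 0
}.

Section Affine.
Variables (k : fieldType) (D : affineDatum k).
Local Notation g := (aff_g D).
Local Notation sigma := (@aff_sigma k D).
Local Notation eta := (@aff_eta k D).
Local Notation hat := (affinization g (aff_nu D)).

(* The coefficient of t^[s] lies in the [eta ^ s]-eigenspace of [sigma]. *)
Definition twisted (f : laurent g) : Prop :=
  forall s, sigma (f s) = eta ^ s *: f s.

Definition affine_pred : {pred hat} := [pred X | `[< twisted (loop_part X) >]].
Definition affine'_pred : {pred hat} :=
  [pred X | `[< twisted (loop_part X) >] && (d_part X == 0)].

Lemma affine_predP X : reflect (twisted (loop_part X)) (X \in affine_pred).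
Proof. exact: asboolP. Qed.
Lemma affine'_predE X : (X \in affine'_pred) = (X \in affine_pred) && (d_part X == 0).
Proof. by []. Qed.

Lemma aff_eta_neq0 : eta != 0.
Proof.
have := prim_expr_order (aff_prim D); have := prim_order_gt0 (aff_prim D).
case: (aff_r D) => // r _ e1; apply/eqP => e0.
by move/eqP: e1; rewrite e0 expr0n /= eq_sym oner_eq0.
Qed.

Lemma twistedP a f h : twisted f -> twisted h -> twisted (a *: f + h).
Proof.
move=> tf th s; rewrite !laurentE linearP /= tf th scalerDr !scalerA.
by rewrite [a * _]mulrC.
Qed.

Lemma twisted0 : twisted 0.
Proof. by move=> s; rewrite laurent0 linear0 scaler0. Qed.

Lemma twisted_lie f h : twisted f -> twisted h -> twisted (loop_lie f h).
Proof.
move=> tf th s; have [r ur fr] := laurent_supp f.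
rewrite !(loop_lieE _ _ ur fr) linear_sum scaler_sumr; apply: eq_bigr => a _.
have [/(_ _ _) -> _] := aff_diag D.
by rewrite /= tf th lieZl lieZr scalerA -expfzDr ?aff_eta_neq0// addrC subrK.
Qed.

Lemma twisted_deriv f : twisted f -> twisted (loop_deriv f).
Proof. by move=> tf s; rewrite /= -scalerMzr -tf raddfMz. Qed.

Fact affine_submod : submod_closed affine_pred.
Proof.
split=> [|a X Y]; first by apply/affine_predP/twisted0.
by move=> /affine_predP tX /affine_predP tY; apply/affine_predP/twistedP.
Qed.

Fact affine_lie_closed X Y :
  X \in affine_pred -> Y \in affine_pred -> lie X Y \in affine_pred.
Proof.
move=> /affine_predP tX /affine_predP tY; apply/affine_predP.
rewrite [loop_part _]loop_part_lie -scaleNr addrC.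
apply: twistedP; first exact: twisted_deriv.
by rewrite addrC; apply: twistedP; [exact: twisted_deriv | exact: twisted_lie].
Qed.

Fact affine'_submod : submod_closed affine'_pred.
Proof.
have [A0 AD] := affine_submod; split=> [|a X Y]; rewrite !affine'_predE.
  by rewrite A0 eqxx.
move=> /andP[AX /eqP X0] /andP[AY /eqP Y0].
apply/andP; split; first exact: AD.
by apply/eqP; rewrite -[LHS]/(a * d_part X + d_part Y) X0 Y0 mulr0 addr0.
Qed.

Fact affine'_lie_closed X Y :
  X \in affine'_pred -> Y \in affine'_pred -> lie X Y \in affine'_pred.
Proof.
rewrite !affine'_predE => /andP[AX _] /andP[AY _].
by rewrite affine_lie_closed//= eqxx.
Qed.

Definition affine_sub := LieSubalgebra affine_submod affine_lie_closed.
Definition affine'_sub := LieSubalgebra affine'_submod affine'_lie_closed.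

(* L = g[t, t^-1]^sigma (+) k c (+) k d *)
Definition affine := lie_sub affine_sub.
(* L' = g[t, t^-1]^sigma (+) k c *)
Definition affine' := lie_sub affine'_sub.

Fact affine_c_subproof : c_elt g (aff_nu D) \in affine_sub.
Proof. exact/affine_predP/twisted0. Qed.
Fact affine'_c_subproof : c_elt g (aff_nu D) \in affine'_sub.
Proof. by apply/andP; split; [exact: affine_c_subproof | rewrite /d_part]. Qed.

(* The central element c, in L and in L'. *)
Definition affine_c : affine := LieSub affine_c_subproof.
Definition affine'_c : affine' := LieSub affine'_c_subproof.

End Affine.

(* Symmetric algebras are taken up to isomorphism, through their universal
   property. *)
Section SymmetricAlgebra.
Variable k : fieldType.

Definition is_symmetric_algebra (V : lmodType k) (S : comAlgType k)
    (i : {linear V -> S}) : Prop :=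
  forall (B : comAlgType k) (f : {linear V -> B}),
    exists2 h : {lrmorphism S -> B}, h \o i =1 f &
      forall h' : {lrmorphism S -> B}, h' \o i =1 f -> h' =1 h.

(* S(V) with the Kostant-Kirillov bracket. *)
Definition is_symmetric_poisson (V : lieAlgType k) (S : poissonAlgType k)
    (i : {linear V -> S}) : Prop :=
  is_symmetric_algebra i /\ forall x y, lie (i x) (i y) = i (lie x y).

End SymmetricAlgebra.

Section PoissonIdeals.
Variables (k : fieldType) (S : poissonAlgType k).

Definition poisson_ideal (I : set S) : Prop :=
  [/\ I 0, forall a b, I a -> I b -> I (a + b),
      forall a b, I b -> I (a * b) & forall a b, I b -> I (lie a b)].

Definition poisson_simple : Prop :=
  forall I : set S, poisson_ideal I -> I = [set 0] \/ I = setT.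

(* [Q] is the Poisson algebra [S / (z)]. *)
Definition is_poisson_quotient (z : S) (Q : poissonAlgType k)
    (q : {lrmorphism S -> Q}) : Prop :=
  [/\ forall b, exists a, q a = b,
      forall a, q a = 0 <-> exists b, a = b * z
    & forall a b, q (lie a b) = lie (q a) (q b)].

End PoissonIdeals.

(* Elements of k[c] inside [S] are the [horner_alg c p]; k(c) is the fraction
   field of k[X], X acting as c. The k(c)-algebra [A] is S (x)_{k[c]} k(c),
   characterized by the universal property of extension of scalars, and its
   Poisson bracket, which is k(c)-bilinear, extends that of [S]. *)
Section BaseChange.
Variables (k : fieldType) (S : poissonAlgType k) (c : S).
Local Notation K := {fraction {poly k}}.

Definition over_kc (B : comAlgType K) (f : {rmorphism S -> B}) : Prop :=
  forall p : {poly k}, f (horner_alg c p) = (tofrac p)%:A.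

Definition is_base_change (A : comAlgType K) (phi : {rmorphism S -> A}) : Prop :=
  over_kc phi /\
  forall (B : comAlgType K) (f : {rmorphism S -> B}), over_kc f ->
    exists2 h : {lrmorphism A -> B}, h \o phi =1 f &
      forall h' : {lrmorphism A -> B}, h' \o phi =1 f -> h' =1 h.

Definition is_poisson_base_change (A : poissonAlgType K)
    (phi : {rmorphism S -> A}) : Prop :=
  is_base_change phi /\ forall a b, phi (lie a b) = lie (phi a) (phi b).

End BaseChange.

(* Main.v *)
Require Import Defs.
From HB Require Import structures.
From mathcomp Require Import all_boot all_order all_fingroup all_algebra.
From mathcomp Require Import generic_quotient.
From mathcomp Require Import boolp classical_sets functions cardinality fsbigop.
From mathcomp Require Import ring zify.

(** Let $J$ be a nonzero Poisson ideal of the symmetric algebra $S$ of $L$ or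
    of $L'$. Replace it by the set of $a$ such that $ca$ is in its radical: in
    characteristic 0 this is again a Poisson ideal, now radical and saturated
    with respect to $c$. The heart of the proof is that such a $J$ is closed
    under all partial derivatives except the one along $c$.

    Take $P$ in $J$. By the chain rule $\{u, P\} = \sum_i p_i \{u, z_i\}$, a
    finite sum over the partial derivatives $p_i$ of $P$, and expanding
    $\{v, \{u, P\}\} \in J$ gives, modulo $J$,
      $\sum_i p_i \{v, \{u, z_i\}\} = - \sum_i \{v, p_i\} \{u, z_i\}$.
    So the left-hand side, as a matrix indexed by $u$ and $v$, has finite rank
    modulo $J$. Let now $u = x t^{s + ra}$ and $v = y t^{s' + rb}$. If $z_i$ is
    a loop element, the entry is affine in $b$ with coefficients depending only
    on $a + b$, and its slope comes from the cocycle, hence is a multiple of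
    $c$ and vanishes unless $a + b$ has one particular value; if $z_i = d$ the
    entry is quadratic in $b$. Subtracting the matrices with $a$,
    respectively $b$, shifted by 1 isolates the highest coefficient: it leaves
    a Hankel matrix of finite rank modulo $J$ whose generating sequence has
    finite support. Such a matrix has triangular minors of arbitrary size, with
    the last nonzero term of the sequence on the diagonal; a minor larger than
    the rank lies in $J$, and as $J$ is radical so do, one after the other, all
    terms of the sequence ([hankel_affine], [hankel_quadratic]). These terms are
    $c$ times derivatives of $P$: the one along $d$ ([partial_d_stable]), and
    then those along the functionals $\kappa(y, [x, X_e])$
    ([partial_killing_stable]), which exhaust the dual of the $e$-th graded piece
    because $\mathfrak g$ is perfect and $\kappa$ is nondegenerate
    ([functional_brackets]).

    An ideal closed under these derivatives is generated by its intersection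
    with $\Bbbk[c]$, by Euler's identity and induction on the degree in the
    other variables ([stable_ideal_sub]). This intersection is therefore nonzero,
    and contains $p(c)$ with $p(\lambda) \neq 0$ as soon as $J$ strictly contains
    $(c - \lambda)$; undoing the saturation gives both parts, and the statement
    over $\Bbbk(c)$ follows by clearing denominators. *)

Set Implicit Arguments.
Unset Strict Implicit.
Unset Printing Implicit Defensive.

Import Order.TTheory GRing.Theory Num.Theory.
Local Open Scope classical_set_scope.
Local Open Scope ring_scope.

(** * Dual numbers and subalgebras *)
Section DualNumbers.
Variables (k : fieldType) (S : comAlgType k).

(** $S[\varepsilon]/(\varepsilon^2)$, the pair $(a, b)$ standing for
    $a + b \varepsilon$: algebra morphisms into it encode derivations. *)
Definition dual_numbers : Type := (S * S)%type.
HB.instance Definition _ := GRing.Lmodule.copy dual_numbers (S * S)%type.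
Implicit Types u v w : dual_numbers.

Definition dual_mul u v : dual_numbers := (u.1 * v.1, u.1 * v.2 + u.2 * v.1).
Definition dual_one : dual_numbers := (1, 0).

Fact dual_mulA : associative dual_mul.
Proof. by move=> u v w; congr pair => /=; ring. Qed.
Fact dual_mulC : commutative dual_mul.
Proof. by move=> u v; congr pair => /=; ring. Qed.
Fact dual_mul1 : left_id dual_one dual_mul.
Proof. by case=> a b; congr pair => /=; ring. Qed.
Fact dual_mulDl : left_distributive dual_mul +%R.
Proof. by move=> u v w; congr pair => /=; ring. Qed.
Fact dual_one_neq0 : dual_one != 0.
Proof. by apply/eqP => -[/eqP]; rewrite oner_eq0. Qed.
HB.instance Definition _ := GRing.Zmodule_isComNzRing.Build dual_numbers
  dual_mulA dual_mulC dual_mul1 dual_mulDl dual_one_neq0.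
Fact dual_scalerAl (a : k) u v : a *: (u * v) = dual_mul (a *: u) v.
Proof.
rewrite -[LHS]/((a *: (u.1 * v.1), a *: (u.1 * v.2 + u.2 * v.1)) : S * S).
by rewrite scalerDr !scalerAl.
Qed.
HB.instance Definition _ := GRing.LSemiModule_isLSemiAlgebra.Build k dual_numbers
  dual_scalerAl.
HB.instance Definition _ := GRing.Lalgebra_isComAlgebra.Build k dual_numbers.
End DualNumbers.

Section Subalgebra.
Variables (k : fieldType) (A : comAlgType k) (P : {pred A}).
Hypothesis P_subalg : GRing.subalg_closed P.

HB.instance Definition _ := GRing.isSubalgClosed.Build k A P
  (GRing.subalg_closed_semi P_subalg).
Record subalgebra := Subalgebra { subalgebra_val :> A; _ : subalgebra_val \in P }.
HB.instance Definition _ := [isSub for subalgebra_val].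
HB.instance Definition _ := [Choice of subalgebra by <:].
(** The proof of closure is a phantom parameter, from which the ring structure
    of the subtype is inferred. *)
Definition subalgebra_of & GRing.subalg_closed P : Type := subalgebra.
Local Notation B := (subalgebra_of P_subalg).
HB.instance Definition _ := SubType.copy B subalgebra.
HB.instance Definition _ := Choice.copy B subalgebra.
HB.instance Definition _ := GRing.SubChoice_isSubComNzRing.Build A P B
  (GRing.subalg_closedBM P_subalg).
HB.instance Definition _ := GRing.SubZmodule_isSubLmodule.Build k A P B
  (GRing.subalg_closed_semi P_subalg).
HB.instance Definition _ := GRing.SubNzRing_SubLmodule_isSubLalgebra.Build k A P B.
HB.instance Definition _ := GRing.SubLalgebra_isSubAlgebra.Build k A P B.


Definition subalgebra_incl (u : B) : A := subalgebra_val u.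
Fact subalgebra_incl_linear : linear subalgebra_incl.
Proof. by []. Qed.
Fact subalgebra_incl_monoid : monoid_morphism subalgebra_incl.
Proof. by []. Qed.
HB.instance Definition _ := GRing.isSemilinear.Build k B A _ subalgebra_incl
  (GRing.semilinear_linear subalgebra_incl_linear).
HB.instance Definition _ := GRing.isMonoidMorphism.Build B A subalgebra_incl
  subalgebra_incl_monoid.
End Subalgebra.

(** * Derivations of a symmetric algebra *)
Definition derivation (k : fieldType) (S : comAlgType k) (D : S -> S) : Prop :=
  linear D /\ forall a b, D (a * b) = D a * b + a * D b.

Section DerivationTheory.
Variables (k : fieldType) (S : comAlgType k) (D : S -> S).
Hypothesis derD : derivation D.

Lemma der_linearP a u v : D (a *: u + v) = a *: D u + D v.
Proof. exact: derD.1. Qed.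
Lemma derM a b : D (a * b) = D a * b + a * D b.
Proof. exact: derD.2. Qed.
Lemma der0 : D 0 = 0.
Proof. by have /eqP := derM 0 0; rewrite !mulr0 mul0r addr0 => /eqP. Qed.
Lemma derDD a b : D (a + b) = D a + D b.
Proof. by have := der_linearP 1 a b; rewrite !scale1r. Qed.
Lemma derZ c a : D (c *: a) = c *: D a.
Proof. by have := der_linearP c a 0; rewrite der0 !addr0. Qed.
Lemma der1 : D 1 = 0.
Proof.
have := derM 1 1; rewrite !mulr1 mul1r => /(congr1 (+%R^~ (- D 1))).
by rewrite subrr addrK.
Qed.
Lemma derA c : D c%:A = 0.
Proof. by rewrite derZ der1 scaler0. Qed.
Lemma der_sum I (r : seq I) (F : I -> S) : D (\sum_(j <- r) F j) = \sum_(j <- r) D (F j).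
Proof.
elim: r => [|j r IHr]; first by rewrite !big_nil der0.
by rewrite !big_cons derDD IHr.
Qed.
Lemma derX a n : D (a ^+ n.+1) = n.+1%:R * a ^+ n * D a.
Proof.
elim: n => [|n IHn]; first by rewrite expr0 !mul1r expr1.
rewrite exprS derM IHn [n.+2%:R]mulrS exprS; move: (n.+1%:R : S) (a ^+ n) => u v.
by ring.
Qed.

Lemma der_horner c p : D c = 0 -> D (horner_alg c p) = 0.
Proof.
move=> Dc; elim/poly_ind: p => [|p a IHp]; first by rewrite rmorph0 der0.
rewrite rmorphD rmorphM /= horner_algX horner_algC derDD derM IHp Dc derA.
by rewrite mul0r mulr0 !addr0.
Qed.
End DerivationTheory.

Section SymmetricAlgebraTheory.
Variables (k : fieldType) (V : lmodType k) (S : comAlgType k) (i : {linear V -> S}).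
Hypothesis SP : is_symmetric_algebra i.

(** The universal property forces $S$ to be generated by the image of $i$: $i$
    factors through the subalgebra cut out by $P$, and the resulting
    endomorphism of $S$ must be the identity. *)
Lemma symmetric_algebra_ind (P : S -> Prop) :
  P 1 -> (forall a u v, P u -> P v -> P (a *: u + v)) ->
  (forall u v, P u -> P v -> P (u * v)) -> (forall x, P (i x)) ->
  forall u, P u.
Proof.
move=> P1 PD PM Pi; pose Q := [pred u | `[< P u >]].
have Qalg : GRing.subalg_closed Q.
  split=> [|a u v /asboolP Pu /asboolP Pv|u v /asboolP Pu /asboolP Pv].
  - exact/asboolP.
  - exact/asboolP/PD.
  - exact/asboolP/PM.
have Qi x : i x \in Q by exact/asboolP.
pose f x : subalgebra_of Qalg := Subalgebra (Qi x).
have f_lin : linear f by move=> a x y; apply/val_inj; rewrite /= linearP.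
pose fL : {linear V -> subalgebra_of Qalg} := HB.pack f
  (GRing.isSemilinear.Build k V _ _ f (GRing.semilinear_linear f_lin)).
have [h hf _] := SP fL; have [h1 _ h1P] := SP i.
pose vh : {lrmorphism S -> S} := @subalgebra_incl _ _ _ Qalg \o h.
have vhi : vh \o i =1 i by move=> x; have /= -> := hf x.
have idi : (idfun : {lrmorphism S -> S}) \o i =1 i by [].
move=> u; have -> : u = subalgebra_incl (h u) by have /= -> := h1P _ vhi u; rewrite -(h1P _ idi u).
exact/asboolP/(valP (h u)).
Qed.

Lemma derivation_eq (D D' : S -> S) : derivation D -> derivation D' ->
  (forall x, D (i x) = D' (i x)) -> D =1 D'.
Proof.
move=> dD dD' DD'; apply: symmetric_algebra_ind => //.
- by rewrite (der1 dD) (der1 dD').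
- by move=> a u v Du Dv; rewrite (der_linearP dD) (der_linearP dD') Du Dv.
- by move=> u v Du Dv; rewrite (derM dD) (derM dD') Du Dv.
Qed.

(** $x \mapsto i(x) + \delta(x) \varepsilon$ extends to the dual numbers. *)
Lemma derivation_exists (delta : V -> S) : linear delta ->
  exists D, derivation D /\ forall x, D (i x) = delta x.
Proof.
move=> dl; pose f x : dual_numbers S := (i x, delta x).
have f_lin : linear f.
  by move=> a x y; rewrite /f linearP dl.
pose fL : {linear V -> dual_numbers S} := HB.pack f
  (GRing.isSemilinear.Build k V _ _ f (GRing.semilinear_linear f_lin)).
have [h hf _] := SP fL.
have h1 u : (h u).1 = u.
  move: u; apply: symmetric_algebra_ind => [|a u v hu hv|u v hu hv|x].
  - by rewrite rmorph1.
  - by rewrite linearP -[RHS]/(a *: u + v) -[in RHS]hu -[in RHS]hv.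
  - by rewrite rmorphM -[in RHS]hu -[in RHS]hv.
  - by have /= -> := hf x.
exists (fun u => (h u).2); split; first split=> [a u v|u v].
- by rewrite linearP.
- by rewrite rmorphM -[LHS]/((h u).1 * (h v).2 + (h u).2 * (h v).1) !h1 addrC.
- by move=> x; have /= -> := hf x.
Qed.

End SymmetricAlgebraTheory.

(** * Matrices of finite rank modulo an ideal *)
Definition ideal (R : comNzRingType) (J : set R) : Prop :=
  [/\ J 0, forall a b, J a -> J b -> J (a + b) & forall a b, J b -> J (a * b)].

Section IdealTheory.
Variables (R : comNzRingType) (J : set R).
Hypothesis idJ : ideal J.

Lemma ideal0 : J 0. Proof. by case: idJ. Qed.
Lemma idealD a b : J a -> J b -> J (a + b). Proof. by case: idJ => _ + _; apply. Qed.
Lemma ideal_mull a b : J b -> J (a * b). Proof. by case: idJ => _ _; apply. Qed.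
Lemma ideal_mulr a b : J a -> J (a * b). Proof. by rewrite mulrC; exact: ideal_mull. Qed.
Lemma idealN a : J a -> J (- a). Proof. by rewrite -mulN1r; exact: ideal_mull. Qed.
Lemma idealB a b : J a -> J b -> J (a - b).
Proof. by move=> Ja Jb; apply/idealD/idealN. Qed.
Lemma idealMn a n : J a -> J (a *+ n).
Proof. by rewrite -mulr_natl; exact: ideal_mull. Qed.
Lemma ideal_sum I (r : seq I) (P : pred I) (F : I -> R) :
  (forall j, P j -> J (F j)) -> J (\sum_(j <- r | P j) F j).
Proof. by move=> JF; apply: (big_ind J) => //; [exact: ideal0|exact: idealD]. Qed.
Lemma idealX a m n : (m <= n)%N -> J (a ^+ m) -> J (a ^+ n).
Proof. by move=> mn Ja; rewrite -(subnK mn) exprD; exact: ideal_mull. Qed.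

Lemma ideal_prod I (r : seq I) (F G : I -> R) :
  (forall j, J (F j - G j)) -> J (\prod_(j <- r) F j - \prod_(j <- r) G j).
Proof.
move=> JFG; elim: r => [|j r IHr]; first by rewrite !big_nil subrr; exact: ideal0.
rewrite !big_cons; set p := \prod_(_ <- r) F _; set q := \prod_(_ <- r) G _.
have -> : F j * p - G j * q = (F j - G j) * p + G j * (p - q) by ring.
by apply: idealD; [exact: ideal_mulr | exact: ideal_mull].
Qed.

Lemma ideal_det n (A B : 'M[R]_n) :
  (forall i j, J (A i j - B i j)) -> J (\det A - \det B).
Proof.
move=> JAB; rewrite /determinant -sumrB; apply: ideal_sum => s _.
by rewrite -mulrBr; apply/ideal_mull/ideal_prod.
Qed.

Definition radical : set R := [set a | exists n, J (a ^+ n)].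

Lemma sub_radical a : J a -> radical a.
Proof. by move=> Ja; exists 1. Qed.

Lemma radical_ideal : ideal radical.
Proof.
split=> [|a b [m Ja] [n Jb]|a b [n Jb]]; first by apply/sub_radical/ideal0.
  exists (m + n)%N; rewrite exprDn; apply: ideal_sum => j _; apply: idealMn.
  have [jn|/ltnW nj] := leqP j n; last by apply/ideal_mull/(idealX nj).
  by apply/ideal_mulr/(idealX _ Ja); rewrite -addnBA// leq_addr.
by exists n; rewrite exprMn; apply: ideal_mull.
Qed.

Lemma radicalX a n : radical (a ^+ n) -> radical a.
Proof. by case=> m; rewrite -exprM; exists (n * m)%N. Qed.

End IdealTheory.

Section FiniteRank.
Variables (R : comNzRingType) (J : set R).
Hypothesis idJ : ideal J.

(** A bi-infinite matrix factors modulo $J$ through a free module of finite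
    rank, namely the length of $s$. *)
Definition finite_rank (A : int -> int -> R) : Prop :=
  exists s : seq ((int -> R) * (int -> R)),
    forall a b, J (A a b - \sum_(uv <- s) uv.1 a * uv.2 b).

Lemma finite_rank_congr A B : (forall a b, J (A a b - B a b)) ->
  finite_rank A -> finite_rank B.
Proof.
move=> JAB [s As]; exists s => a b.
by have := idealB idJ (As a b) (JAB a b); congr J; ring.
Qed.

Lemma finite_rankB A B : finite_rank A -> finite_rank B ->
  finite_rank (fun a b => A a b - B a b).
Proof.
move=> [s As] [t Bt]; exists (s ++ [seq (fun a => - uv.1 a, uv.2) | uv <- t]).
move=> a b; have := idealB idJ (As a b) (Bt a b).
rewrite big_cat big_map /=.
have -> : \sum_(uv <- t) - uv.1 a * uv.2 b = - \sum_(uv <- t) uv.1 a * uv.2 b.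
  by rewrite -sumrN; apply: eq_bigr => uv _; rewrite mulNr.
move: (\sum_(_ <- s) _) (\sum_(_ <- t) _) => x y.
by congr J; ring.
Qed.

Lemma finite_rank_shift A m n :
  finite_rank A -> finite_rank (fun a b => A (a + m) (b + n)).
Proof.
move=> [s As]; exists [seq ((fun a => uv.1 (a + m)), (fun b => uv.2 (b + n))) | uv <- s].
by move=> a b; rewrite big_map; exact: As.
Qed.

(** Pad the two factors with zeros to square matrices. *)
Lemma det_mulmx_small (n : nat) (U : 'M[R]_(n + 1, n)) (V : 'M[R]_(n, n + 1)) :
  \det (U *m V) = 0.
Proof.
have -> : U *m V = row_mx U (0 : 'cV_(n + 1)) *m col_mx V 0.
  by rewrite mul_row_col mul0mx addr0.
rewrite det_mulmx (expand_det_col _ (rshift n ord0)) big1 ?mul0r// => j _.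
by rewrite row_mxEr mxE mul0r.
Qed.

Hypothesis radJ : forall a n, J (a ^+ n) -> J a.

(** With $n$ the rank, the minor on rows $s_0 + j$ and columns $-l$, for
    $0 \le j, l \le n$, vanishes modulo $J$. It is triangular modulo $J$, with
    $G(s_0)$ all along the diagonal. *)
Lemma hankel_finite_rank (G : int -> R) s0 : finite_rank (fun a b => G (a + b)) ->
  (forall s, s > s0 -> J (G s)) -> J (G s0).
Proof.
move=> [t Gt] Gs0; pose n := size t.
pose U := \matrix_(j < n + 1, l < n) (nth (fun=> 0, fun=> 0) t l).1 (s0 + j%:Z).
pose V := \matrix_(l < n, j < n + 1) (nth (fun=> 0, fun=> 0) t l).2 (- j%:Z).
pose B := \matrix_(j < n + 1, l < n + 1)
  (if (l < j)%N then 0 else G (s0 + j%:Z - l%:Z)).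
have JBUV : J (\det B - \det (U *m V)).
  apply: ideal_det => // j l; rewrite !mxE.
  have := Gt (s0 + j%:Z) (- l%:Z); rewrite (big_nth (fun=> 0, fun=> 0)) big_mkord.
  have -> : \sum_(m < n) U j m * V m l = \sum_(m < size t)
    (nth (fun=> 0, fun=> 0) t m).1 (s0 + j%:Z) *
    (nth (fun=> 0, fun=> 0) t m).2 (- l%:Z) by apply: eq_bigr => m _; rewrite !mxE.
  case: ifP => // lj; move: (\sum_(_ < _) _) => x Jx.
  have Jg : J (G (s0 + j%:Z - l%:Z)) by apply: Gs0; lia.
  by have := idealB idJ Jx Jg; congr J; ring.
move: JBUV; rewrite det_mulmx_small subr0 -det_tr det_trig.
  rewrite (eq_bigr (fun=> G s0)) => [|j _]; last by rewrite !mxE ltnn addrK.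
  by rewrite prodr_const; exact: radJ.
by apply/is_trig_mxP => j l jl; rewrite !mxE jl.
Qed.
End FiniteRank.

Section Hankel.
Variables (R : comNzRingType) (J : set R).
Hypothesis idJ : ideal J.
Hypothesis radJ : forall a n, J (a ^+ n) -> J a.

Lemma hankel_bounded (G : int -> R) s1 : finite_rank J (fun a b => G (a + b)) ->
  (forall s, s > s1 -> J (G s)) -> forall s, J (G s).
Proof.
move=> rG Gs1 s.
suff JG n : forall s, s > s1 - n%:Z -> J (G s) by apply: (JG `|s1 - s|.+1); lia.
elim: n => [|n IHn] s' sn; first by apply: Gs1; lia.
have [/IHn//|ns'] := ltrP (s1 - n%:Z) s'.
by apply: (hankel_finite_rank idJ radJ rG) => s'' s''s'; apply: IHn; lia.
Qed.

(** The difference between the matrices shifted by one in $a$ and in $b$ is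
    $- F_1(a + b + 1)$. *)
Lemma hankel_affine (F0 F1 : int -> R) s1 :
  finite_rank J (fun a b => F0 (a + b) + F1 (a + b) *~ b) ->
  (forall s, s > s1 -> J (F1 s)) -> forall s, J (F1 s).
Proof.
move=> rF Fs1 s; suff JG : J (- F1 (s - 1 + 1)).
  by move: (idealN idJ JG); rewrite opprK subrK.
apply: (@hankel_bounded (fun s => - F1 (s + 1)) s1) => [|s' ss']; last first.
  by apply: (idealN idJ); apply: Fs1; lia.
have := finite_rankB idJ (finite_rank_shift 1 0 rF) (finite_rank_shift 0 1 rF).
apply: finite_rank_congr => // a b /=.
rewrite !addr0 [b + 1]addrC addrA [a + 1 + b]addrAC mulrzDr mulr1z.
set x := F0 _; set y := F1 _; set z := y *~ b.
suff -> : x + z - (x + (y + z)) - - y = 0 by exact: (ideal0 idJ).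
by ring.
Qed.

(** The same difference turns the coefficient $F_2$ of $b^2$ into the slope
    $- 2 F_2$. *)
Lemma hankel_quadratic (F0 F1 F2 : int -> R) s1 :
  (forall a, J (a *+ 2) -> J a) ->
  finite_rank J (fun a b => F0 (a + b) + F1 (a + b) *~ b + F2 (a + b) *~ (b * b)) ->
  (forall s, s > s1 -> J (F2 s)) -> forall s, J (F2 s).
Proof.
move=> J2 rF Fs1 s; apply: J2.
suff JG : J (- (F2 (s - 1 + 1) *+ 2)).
  by move: (idealN idJ JG); rewrite opprK subrK.
apply: (@hankel_affine (fun s => - F1 (s + 1) - F2 (s + 1))
  (fun s => - (F2 (s + 1) *+ 2)) s1) => [|s' ss']; last first.
  by apply: (idealN idJ); apply: (idealMn idJ); apply: Fs1; lia.
have := finite_rankB idJ (finite_rank_shift 1 0 rF) (finite_rank_shift 0 1 rF).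
apply: finite_rank_congr => // a b /=.
rewrite !addr0 [b + 1]addrC addrA [a + 1 + b]addrAC.
move: (F0 _) (F1 _) (F2 _) => x y z.
have E1 : (1 + b)%:~R = 1 + b%:~R :> R by rewrite intrD.
have E2 : z *~ ((1 + b) * (1 + b)) = z * ((1 + b%:~R) * (1 + b%:~R)).
  by rewrite -E1 -intrM mulrzr.
have E3 : z *~ (b * b) = z * (b%:~R * b%:~R) by rewrite -intrM mulrzr.
have E4 (u : R) : u *~ b = u * b%:~R by rewrite mulrzr.
rewrite E2 E3 mulrzDr mulr1z !(E4 y) !(E4 (- (z *+ 2))).
move: (b%:~R : R) => t.
match goal with |- J ?u => suff -> : u = 0 by exact: (ideal0 idJ) end.
by ring.
Qed.
End Hankel.

(** * Radical and saturation of Poisson ideals *)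
Section IdealScaling.
Variables (k : fieldType) (char0 : [pchar k] =i pred0) (S : comAlgType k).
Implicit Types J : set S.

Lemma natr_char0 n : (n.+1%:R : k) != 0.
Proof. by have /pcharf0P -> := char0. Qed.

Lemma idealZ J c a : ideal J -> J a -> J (c *: a).
Proof. by move=> idJ Ja; rewrite -mulr_algl; apply: ideal_mull. Qed.

Lemma idealZ_inv J c a : ideal J -> c != 0 -> J (c *: a) -> J a.
Proof. by move=> idJ c0 /(idealZ c^-1 idJ); rewrite scalerA mulVf// scale1r. Qed.

Lemma idealMn_inv J n a : ideal J -> J (a *+ n.+1) -> J a.
Proof.
move=> idJ Ja; apply: (@idealZ_inv _ n.+1%:R) => //; first exact: natr_char0.
by rewrite scaler_nat.
Qed.

End IdealScaling.

Section PoissonRadical.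
Variables (k : fieldType) (char0 : [pchar k] =i pred0) (S : poissonAlgType k).
Implicit Types I J : set S.

Lemma poisson_ideal_ideal I : poisson_ideal I -> ideal I.
Proof. by case. Qed.

Lemma lie_derivation (u : S) : derivation (lie u).
Proof. by split=> [a x y|a b]; [exact: linearP | exact: lie_leibniz]. Qed.

(** If $a^n \in I$ then $a^{n-m} (Da)^{2m-1} \in I$ for $1 \le m \le n$, by
    induction: apply $D$, multiply by $Da$ and remove the term in $D^2 a$, which
    is a multiple of the previous element. Each step divides by an integer. *)
Lemma poisson_radical I : poisson_ideal I -> poisson_ideal (radical I).
Proof.
move=> PI; have idI := poisson_ideal_ideal PI; have [_ _ _ Ilie] := PI.
have [R0 RD RM] := radical_ideal idI; split=> // u a [[|n] Ia].
  by exists 0; rewrite expr0 in Ia *.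
have dD := lie_derivation u; set D := lie u in dD.
suff Dn m : (m <= n)%N -> I (a ^+ (n - m) * D a ^+ m.*2.+1).
  by exists n.*2.+1; have := Dn n (leqnn n); rewrite subnn mul1r.
elim: m => [_|m IHm mn].
  rewrite subn0 expr1; apply: (idealMn_inv char0 (n := n)) => //.
  by have := Ilie u _ Ia; rewrite -/D (derX dD) -mulrA mulr_natl.
have {IHm} := IHm (ltnW mn); rewrite -(subnSK mn).
move: (n - m.+1)%N => l Ilm.
apply: (idealMn_inv char0 (n := l)) => //.
have := Ilie u _ Ilm; rewrite -/D (derM dD) !(derX dD) => I1.
have := idealB idI (ideal_mull idI (D a) I1)
  (ideal_mull idI (m.*2.+1%:R * D (D a)) Ilm).
congr I; rewrite -[RHS]mulr_natl doubleS !exprS; move: (D a ^+ m.*2) => G.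
move: (l.+1%:R : S) (m.*2.+1%:R : S) (D (D a)) (D a) (a ^+ l) => A B C E F.
by ring.
Qed.

Variable c : S.
Hypothesis c_central : forall a, lie a c = 0.

(** Since radical ideals are closed under taking roots, a single factor $c$
    already makes this saturated with respect to all powers of $c$. *)
Definition saturated_radical I : set S := [set a | radical I (c * a)].

Lemma poisson_saturated_radical I : poisson_ideal I -> poisson_ideal (saturated_radical I).
Proof.
move=> /poisson_radical[R0 RD RM Rlie]; split=> [|a b|a b|a b] /=.
- by rewrite /saturated_radical /= mulr0.
- by rewrite /saturated_radical /= mulrDr; exact: RD.
- by rewrite /saturated_radical /= mulrCA; exact: RM.
- by rewrite /saturated_radical /= => /(Rlie a); rewrite lie_leibniz c_central mul0r add0r.
Qed.

Lemma sub_saturated_radical I a : poisson_ideal I -> I a -> saturated_radical I a.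
Proof.
by move=> PI Ia; apply: sub_radical; apply: ideal_mull => //; apply: poisson_ideal_ideal.
Qed.

Lemma saturated_radicalX I a n : poisson_ideal I ->
  saturated_radical I (a ^+ n) -> saturated_radical I a.
Proof.
move=> PI; have idR := radical_ideal (poisson_ideal_ideal PI) => Ra.
apply: (@radicalX _ _ _ n.+1).
have -> : (c * a) ^+ n.+1 = (c ^+ n * a) * (c * a ^+ n).
  by rewrite exprMn !exprS; move: (c ^+ n) (a ^+ n) => u v; ring.
exact: ideal_mull.
Qed.

Lemma saturated_radical_cancel I a : poisson_ideal I ->
  saturated_radical I (c * a) -> saturated_radical I a.
Proof.
move=> PI; have idR := radical_ideal (poisson_ideal_ideal PI) => Ra.
apply: (@radicalX _ _ _ 2); have -> : (c * a) ^+ 2 = a * (c * (c * a)) by ring.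
exact: ideal_mull.
Qed.

End PoissonRadical.

(** * The Killing form of a simple Lie algebra *)
Section LinearAlgebra.
Variables (k : fieldType) (g : vectType k).

(** Extracts from an arbitrary set of vectors a basis of its span. *)
Lemma maximal_free (P : g -> Prop) : exists X : seq g,
  [/\ free X, forall x, x \in X -> P x & forall v, P v -> v \in <<X>>%VS].
Proof.
pose Q n := `[< exists X : seq g, [/\ free X, forall x, x \in X -> P x & size X = n] >].
have Q0 : exists n, Q n.
  by exists 0%N; apply/asboolP; exists [::]; split=> //; exact: nil_free.
have Qle n : Q n -> (n <= \dim {:g})%N.
  move=> /asboolP[X [freeX _ <-]]; move: freeX; rewrite /free => /eqP <-.
  exact/dimvS/subvf.
case: (ex_maxnP Q0 Qle) => n /asboolP[X [freeX XP sX]] nmax.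
exists X; split=> // v Pv; apply/negPn/negP => vX.
suff /nmax : Q n.+1 by rewrite ltnn.
apply/asboolP; exists (v :: X); split; rewrite /= ?sX ?free_cons ?vX//.
by move=> x; rewrite inE => /predU1P[->//|]; exact: XP.
Qed.

Lemma mxtrace_basis (e e' : (\dim {:g}).-tuple g) (f : 'End(g)) :
  basis_of fullv e -> basis_of fullv e' ->
  \tr (passmx.mxof e e f) = \tr (passmx.mxof e' e' f).
Proof.
move=> be be'.
rewrite -[f in LHS]comp_lfun1r (passmx.mxof_comp _ _ be') mxtrace_mulC.
by rewrite -(passmx.mxof_comp _ _ be) comp_lfun1l.
Qed.

Lemma mxtrace_eigenbasis (e : (\dim {:g}).-tuple g) (f : 'End(g)) (c : 'I_(\dim {:g}) -> k) :
  basis_of fullv e -> (forall j : 'I__, f e`_j = c j *: e`_j) ->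
  \tr (passmx.mxof e e f) = \sum_j c j.
Proof.
move=> be fe; apply: eq_bigr => j _; rewrite mxE /= passmx.vecof_delta fe.
by rewrite mxE linearZ /= coord_free ?(basis_free be)// eqxx mulr1.
Qed.
End LinearAlgebra.

Lemma dim_rV (k : fieldType) n : \dim {:'rV[k]_n} = n.
Proof. by rewrite dimvf; exact: mul1n. Qed.

Section SimpleLie.
Variables (k : fieldType) (g : finLieAlgType k).
Hypothesis simple_g : simple_Lie g.
Implicit Types x y z : g.

Lemma center_eq0 z : (forall x, lie x z = 0) -> z = 0.
Proof.
move=> cz; have [[x [y /eqP xy0]] simp] := simple_g.
have [|z0|zT] := simp <[z]>%VS.
- by move=> u v /vlineP[a ->]; rewrite lieZr cz scaler0 mem0v.
- by apply/eqP; rewrite -memv0 -z0 memv_line.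
- case: xy0; have : y \in <[z]>%VS by rewrite zT memvf.
  by move=> /vlineP[a ->]; rewrite lieZr cz scaler0.
Qed.

(** The subspace $U$ contains all brackets, so it is a nonzero ideal. *)
Lemma brackets_span (H : g -> Prop) :
  (forall x, exists n (h : 'I_n -> g), (forall j, H (h j)) /\ x = \sum_j h j) ->
  forall U : {vspace g}, (forall x y, H x -> H y -> lie x y \in U) -> U = fullv.
Proof.
move=> spanH U UH; have [[x [y /eqP xy0]] simp] := simple_g.
have UL u v : lie u v \in U.
  have [m [h [Hh ->]]] := spanH u; have [n [h' [Hh' ->]]] := spanH v.
  rewrite linear_sum; apply: memv_suml => j _ /=; rewrite lieC rpredN linear_sum.
  by apply: memv_suml => l _; apply: UH.
have [u v _|U0|//] := simp U; first exact: UL.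
by case: xy0; apply/eqP; rewrite -memv0 -U0 UL.
Qed.


Hypothesis char0 : [pchar k] =i pred0.

Lemma intr_char0 (z : int) : z%:~R = 0 :> k -> z = 0.
Proof.
have natr0 n : n%:R = 0 :> k -> n = 0%N.
  by have /pcharf0P cP := char0; move/eqP; rewrite cP => /eqP.
case: z => n; first by move=> /natr0 ->.
by rewrite NegzE mulrNz => /eqP; rewrite oppr_eq0 => /eqP/natr0.
Qed.

Lemma lie_lie x y z : lie x (lie y z) = lie (lie x y) z + lie y (lie x z).
Proof.
have := lie_jacobi x y z; rewrite (lieC z x) (lieC z (lie x y)) linearN /=.
by move/eqP; rewrite -addrA -opprD subr_eq0 => /eqP ->; rewrite addrC.
Qed.

Definition ad_eigenvector x y : Prop := exists m : int, lie x y = y *~ m.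

Lemma ad_eigenvector_lie x y z :
  ad_eigenvector x y -> ad_eigenvector x z -> ad_eigenvector x (lie y z).
Proof.
move=> [m xy] [n xz]; exists (m + n); rewrite lie_lie xy xz mulrzDr.
by rewrite -[y *~ m]scaler_int lieZl scaler_int raddfMz.
Qed.

Lemma span_lie (X : seq g) (U : {vspace g}) :
  (forall x y, x \in X -> y \in X -> lie x y \in U) ->
  forall u v, u \in <<X>>%VS -> v \in <<X>>%VS -> lie u v \in U.
Proof.
move=> XU u v /(@coord_span _ _ _ (in_tuple X)) -> /(@coord_span _ _ _ (in_tuple X)) ->.
rewrite linear_sum; apply: memv_suml => j _ /=; rewrite lieC rpredN linear_sum.
apply: memv_suml => l _ /=; rewrite lieZl lieZr !rpredZ//.
by apply: XU; exact: mem_nth.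
Qed.

(** Let $H$ be a simple coroot. The span of the eigenvectors of $\mathrm{ad} H$
    with integer eigenvalues is a subalgebra containing the Chevalley
    generators, hence everything. So $\kappa(H, H)$ is a sum of squares of
    integers, which in characteristic 0 vanishes only if $H$ is central. *)
Lemma killing_chevalley n (A : 'M[int]_n) (e f h : 'I_n -> g) :
  chevalley_generators A e f h -> exists x y : g, killing x y != 0.
Proof.
case=> _ _ _ freeh hh _ he hf gen.
case: n => [|n] in A e f h freeh hh he hf gen *.
  (* Without generators the algebra would be zero. *)
  have [[x [y /eqP xy0]] _] := simple_g.
  have g0 : 0%VS = {:g}%VS.
    apply: gen => [u v|[]//].
    by rewrite !memv0 => /eqP -> _; rewrite lie0l.
  by case: xy0; apply/eqP; rewrite -memv0 g0 memvf.
pose H := h ord0; exists H, H.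
have [X [freeX XH HX]] := maximal_free (ad_eigenvector H).
have spanX : <<X>>%VS = fullv.
  apply: gen => [|j].
    by apply: span_lie => x y /XH Hx /XH Hy; apply/HX/ad_eigenvector_lie.
  apply/andP; split; apply: HX; first by exists (A ord0 j); exact: he.
  by exists (- A ord0 j); rewrite hf mulrNz.
have sX : size X == \dim {:g} by rewrite -spanX eq_sym; exact: freeX.
pose T := Tuple sX.
have basisT : basis_of fullv T by rewrite basisEfree freeX spanX subvv size_tuple leqnn.
have /choice[m mP] (j : 'I_(\dim {:g})) : exists m : int, lie H T`_j = m%:~R *: T`_j.
  have [|m ->] := XH T`_j; first by rewrite mem_nth// size_tuple.
  by exists m; rewrite scaler_int.
apply/eqP => kH; have m0 j : m j = 0.
  have : \sum_j (m j ^+ 2) = 0.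
    apply: intr_char0; rewrite rmorph_sum -[RHS]kH /killing.
    rewrite (mxtrace_basis _ (vbasisP _) basisT).
    rewrite (mxtrace_eigenbasis (c := fun j => (m j ^+ 2)%:~R) basisT)// => l.
    by rewrite !lfunE /= !lfunE /= mP lieZr mP scalerA rmorphXn expr2.
  move/eqP; rewrite psumr_eq0 => [/allP/(_ j)|l _]; last exact: sqr_ge0.
  by rewrite mem_index_enum sqrf_eq0 => /(_ isT)/eqP.
have H0 : H = 0.
  apply: center_eq0 => x; rewrite (coord_basis basisT (memvf x)).
  rewrite lieC linear_sum big1 ?oppr0// => j _ /=.
  by rewrite lieZr mP m0 scale0r scaler0.
have : H \in [seq h j | j <- enum 'I_n.+1] by apply/map_f; rewrite mem_enum.
by move/(free_not0 freeh); rewrite H0 eqxx.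
Qed.

Hypothesis killing_neq0 : exists x y : g, killing x y != 0.


Let killing_coords x : 'rV[k]_(\dim {:g}) := \row_j killing x (vbasis {:g})`_j.
Fact killing_coords_linear : linear killing_coords.
Proof. by move=> a x y; apply/rowP => j; rewrite !mxE killing_linearl. Qed.
HB.instance Definition _ := GRing.isSemilinear.Build k g _ _ killing_coords
  (GRing.semilinear_linear killing_coords_linear).

Lemma eq_on_basis (f h : g -> k) : linear_for *%R f -> linear_for *%R h ->
  (forall j : 'I_(\dim {:g}), f (vbasis {:g})`_j = h (vbasis {:g})`_j) -> f =1 h.
Proof.
move=> fl hl fh y; have zero F : linear_for *%R F -> F (0 : g) = 0 :> k.
  by move=> Fl; have := Fl (-1) 0 0; rewrite scaler0 addr0 mulN1r addNr.
rewrite (coord_vbasis (memvf y)).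
apply: (big_ind (fun y => f y = h y)) => [|u v u0 v0|j _].
- by rewrite !zero.
- by have := fl 1 u v; have := hl 1 u v; rewrite scale1r !mul1r => -> ->; rewrite u0 v0.
- by rewrite -[_ *: _]addr0 fl hl !zero// fh.
Qed.

Let killing_map := linfun killing_coords.

(** The radical of the Killing form is an ideal, and it is not everything. *)
Lemma killing_map_ker : lker killing_map = 0%VS.
Proof.
have kerP x : reflect (forall y, killing x y = 0) (x \in lker killing_map).
  rewrite memv_ker lfunE /=; apply: (iffP eqP) => [/rowP f0 y|x0].
    apply: (eq_on_basis (h := fun=> 0)) => [|a u v|j].
    - exact: killing_linearr.
    - by rewrite mulr0 addr0.
    - by have := f0 j; rewrite !mxE.
  by apply/rowP => j; rewrite !mxE x0.
have [_ simp] := simple_g; have [x u /kerP u0|//|kerT] := simp (lker killing_map).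
  apply/kerP => y; rewrite lieC -[- _]addr0 -scaleN1r killing_linearl.
  by rewrite killing_lie u0 killing0l mulr0 addr0.
by have [x [y /eqP[]]] := killing_neq0; apply/kerP; rewrite kerT memvf.
Qed.

Lemma killing_represents (f : g -> k) : linear_for *%R f ->
  exists w, f =1 killing w.
Proof.
move=> f_lin; pose r : 'rV[k]_(\dim {:g}) := \row_j f (vbasis {:g})`_j.
have : r \in limg killing_map.
  suff -> : limg killing_map = fullv by rewrite memvf.
  have dimK : \dim (limg killing_map) = \dim {:g}.
    have := limg_ker_dim killing_map fullv.
    by rewrite killing_map_ker capv0 dimv0 add0n.
  by apply/eqP; rewrite eqEdim subvf dimK dim_rV leqnn.
move=> /memv_imgP[w _ /rowP rw]; exists w; apply: eq_on_basis => //.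
  exact: killing_linearr.
by move=> j; have := rw j; rewrite lfunE !mxE.
Qed.

End SimpleLie.

(** * The grading by eigenspaces of the diagram automorphism *)
Lemma prim_root_neq0 (k : fieldType) r (eta : k) :
  (0 < r)%N -> r.-primitive_root eta -> eta != 0.
Proof.
move=> r_gt0 eta_prim; apply/eqP => e0; have := prim_expr_order eta_prim.
by rewrite e0 expr0n eqn0Ngt r_gt0 => /eqP; rewrite eq_sym oner_eq0.
Qed.

Section Grading.
Variables (k : fieldType) (char0 : [pchar k] =i pred0) (g : finLieAlgType k).
Variables (sigma : {linear g -> g}) (r : nat) (eta : k).
Hypothesis sigma_lie : Lie_endomorphism sigma.
Hypothesis r_gt0 : (0 < r)%N.
Hypothesis sigma_r : iter r sigma =1 id.
Hypothesis eta_prim : r.-primitive_root eta.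
Implicit Types x y z : g.

Definition homogeneous (s : int) x : Prop := sigma x = eta ^ s *: x.

Let r_neq0 : r%:R != 0 :> k.
Proof. by have /pcharf0P -> := char0; rewrite -lt0n. Qed.

Let eta_neq0 : eta != 0 := prim_root_neq0 r_gt0 eta_prim.

Lemma homogeneousZ s a x : homogeneous s x -> homogeneous s (a *: x).
Proof. by move=> hx; rewrite /homogeneous linearZ /= hx !scalerA mulrC. Qed.

Lemma homogeneous_lie s t x y :
  homogeneous s x -> homogeneous t y -> homogeneous (s + t) (lie x y).
Proof.
by move=> hx hy; rewrite /homogeneous sigma_lie hx hy lieZl lieZr scalerA expfzDr.
Qed.

Lemma homogeneous_mod s t x : eta ^ s = eta ^ t -> homogeneous s x -> homogeneous t x.
Proof. by rewrite /homogeneous => ->. Qed.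

Lemma expz_prim_mul (a : int) : eta ^ (r%:Z * a) = 1.
Proof. by rewrite -exprz_exp -exprnP (prim_expr_order eta_prim) exp1rz. Qed.

Lemma expz_prim_eq1 (a : int) : eta ^ a = 1 -> exists b, a = r%:Z * b.
Proof.
move=> ea; exists (a %/ r%:Z)%Z; rewrite {1}(divz_eq a r%:Z).
have r0 : r%:Z != 0 by rewrite eqz_nat -lt0n.
have : eta ^ (a %% r%:Z)%Z = 1.
  by rewrite /modz expfzDr// ea mul1r -mulNr mulrC expz_prim_mul.
have := modz_ge0 a r0; have := ltz_mod a r0; case: (a %% r%:Z)%Z => // m mr _.
rewrite -exprnP => /eqP; rewrite -(prim_order_dvd eta_prim) => rm.
have -> : m = 0%N by apply/eqP; move: rm; rewrite /dvdn modn_small//; lia.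
by rewrite addr0 mulrC.
Qed.

(** The projection onto the $\eta^s$-eigenspace, by averaging over the powers of
    $\sigma$. *)
Definition component (s : int) x : g :=
  r%:R^-1 *: \sum_(j < r) (eta ^ (- s)) ^+ j *: iter j sigma x.

Lemma component_homogeneous s x : homogeneous s (component s x).
Proof.
rewrite /homogeneous /component linearZ /= linear_sum scalerA mulrC -scalerA.
congr (_ *: _); pose F j : g := (eta ^ (- s)) ^+ j *: iter j sigma x.
have -> : \sum_(j < r) (eta ^ (- s)) ^+ j *: iter j sigma x = \sum_(j < r) F j.+1.
  have Fr : F r = F 0%N.
    by rewrite /F sigma_r expr0 exprnP exprz_exp mulrC expz_prim_mul.
  have := big_ord_recl r (fun j => F (nat_of_ord j)) : \sum_(j < r.+1) F j = _.
  rewrite big_ord_recr /= -/(F _) Fr addrC => /addrI ->.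
  by [].
rewrite scaler_sumr; apply: eq_bigr => j _; rewrite linearZ /= /F scalerA exprS mulrA.
by rewrite -expfzDr// subrr expr0z mul1r.
Qed.

Lemma iter_homogeneous s x j : homogeneous s x -> iter j sigma x = (eta ^ s) ^+ j *: x.
Proof.
move=> hx; elim: j => [|j IHj]; first by rewrite scale1r.
by rewrite iterS IHj linearZ /= hx scalerA exprSr.
Qed.

Lemma component_id s x : homogeneous s x -> component s x = x.
Proof.
move=> hx; rewrite /component (eq_bigr (fun=> x)) => [|j _]; last first.
  by rewrite (iter_homogeneous _ hx) scalerA -exprMn -expfzDr// addNr expr1n scale1r.
by rewrite sumr_const card_ord -scaler_nat scalerA mulVf// scale1r.
Qed.

Lemma component_linear s : linear (component s).
Proof.
move=> a x y; rewrite /component scalerA mulrC -scalerA -scalerDr.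
congr (_ *: _); rewrite scaler_sumr -big_split; apply: eq_bigr => j _ /=.
have -> : iter j sigma (a *: x + y) = a *: iter j sigma x + iter j sigma y.
  by elim: (nat_of_ord j) => //= n ->; rewrite linearP.
by rewrite scalerDr !scalerA mulrC.
Qed.

Lemma component_sum x : x = \sum_(s < r) component s x.
Proof.
rewrite /component -scaler_sumr exchange_big /=.
rewrite (bigD1 (Ordinal r_gt0))//= [X in _ + X]big1 ?addr0 => [|j j0].
  rewrite (eq_bigr (fun=> x)) => [|s _]; last by rewrite expr0 scale1r.
  by rewrite sumr_const card_ord -scaler_nat scalerA mulVf// scale1r.
rewrite -scaler_suml; set S := \sum_(_ < _) _; suff -> : S = 0 by rewrite scale0r.
pose w := eta ^- j; have SE : S = \sum_(s < r) w ^+ s.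
  apply: eq_bigr => s _.
  by rewrite /w exprnN !exprnP !exprz_exp mulrC; congr (_ ^ _); ring.
have w1 : w - 1 != 0.
  rewrite subr_eq0 /w invr_eq1 -(prim_order_dvd eta_prim).
  by rewrite gtnNdvd// lt0n.
apply/(mulfI w1); rewrite mulr0 SE -subrX1 /w exprVn -exprM mulnC exprM.
by rewrite (prim_expr_order eta_prim) expr1n invr1 subrr.
Qed.

(** $\mathrm{ad}(\sigma x) = \sigma \, \mathrm{ad}(x) \, \sigma^{-1}$, with
    $\sigma^{-1} = \sigma^{r - 1}$. *)
Lemma killing_sigma x y : killing (sigma x) (sigma y) = killing x y.
Proof.
pose s' z := iter r.-1 sigma z.
have s'_lin : linear s'.
  by move=> a u v; rewrite /s'; elim: r.-1 => //= n ->; rewrite linearP.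
pose S' : {linear g -> g} := HB.pack s'
  (GRing.isSemilinear.Build k g _ _ s' (GRing.semilinear_linear s'_lin)).
have sK z : S' (sigma z) = z by rewrite /= /s' -iterSr prednK// sigma_r.
have s'K z : sigma (S' z) = z by rewrite /= /s' -iterS prednK// sigma_r.
have adE : (ad (sigma x) \o ad (sigma y))%VF =
    (linfun sigma \o ((ad x \o ad y) \o linfun S'))%VF.
  apply/lfunP => z; do !rewrite lfunE /=.
  by rewrite !sigma_lie (lfunE S') s'K.
rewrite /killing adE (passmx.mxof_comp _ _ (vbasisP _)) mxtrace_mulC.
rewrite -(passmx.mxof_comp _ _ (vbasisP _)); congr (\tr (passmx.mxof _ _ _)).
by apply/lfunP => z; do !rewrite lfunE /=; rewrite (lfunE S') sK.
Qed.

Lemma killing_homogeneous s t x y : homogeneous s x -> homogeneous t y ->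
  eta ^ (s + t) != 1 -> killing x y = 0.
Proof.
move=> hx hy st; have := killing_sigma x y; rewrite hx hy.
have kZl a u v : killing (a *: u) v = a * killing u v :> k.
  by rewrite -[_ *: _]addr0 killing_linearl killing0l addr0.
rewrite kZl killingC kZl killingC mulrA -expfzDr// => /eqP.
by rewrite -subr_eq0 -{2}[killing x y]mul1r -mulrBl mulf_eq0 subr_eq0 (negPf st) => /eqP.
Qed.

Hypothesis simple_g : simple_Lie g.
Hypothesis killing_neq0 : exists x y : g, killing x y != 0.

(** By nondegeneracy $f = \kappa(w, \cdot)$, and $w$ is a sum of brackets $[y, x]$
    of homogeneous elements since $\mathfrak g$ is perfect; then use
    $\kappa([y, x], z) = \kappa(y, [x, z])$. *)
Lemma functional_brackets (f : g -> k) : linear_for *%R f ->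
  exists X : seq (g * g),
    (forall x y, (x, y) \in X -> exists s t, homogeneous s x /\ homogeneous t y) /\
    forall z, f z = \sum_(xy <- X) killing xy.2 (lie xy.1 z).
Proof.
move=> f_lin; have [w fw] := killing_represents simple_g killing_neq0 f_lin.
pose P v := exists x y, v = lie y x /\ exists s t, homogeneous s x /\ homogeneous t y.
have [X [_ XP PX]] := maximal_free P.
have spanX : <<X>>%VS = fullv.
  apply: (brackets_span simple_g (H := fun x => exists s, homogeneous s x)).
    move=> x; exists r, (fun s => component s x); split; last exact: component_sum.
    by move=> s; exists s; exact: component_homogeneous.
  by move=> x y [s hx] [t hy]; apply: PX; exists y, x; split=> //; exists t, s.
have {fw} fw z : f z = killing w z by [].
have : w \in <<X>>%VS by rewrite spanX memvf.
move=> /(@coord_span _ _ _ (in_tuple X)) wE.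
have /choice[xy xyP] (j : 'I_(size X)) : exists xy : g * g,
    coord (in_tuple X) j w *: (in_tuple X)`_j = lie xy.2 xy.1 /\
    exists s t, homogeneous s xy.1 /\ homogeneous t xy.2.
  have [|x [y [-> [s [t [hx hy]]]]]] := XP (in_tuple X)`_j; first exact: mem_nth.
  exists (x, coord (in_tuple X) j w *: y); rewrite lieZl; split=> //.
  by exists s, t; split=> //; exact: homogeneousZ.
exists [seq xy j | j <- enum 'I_(size X)]; split.
  by move=> x y /mapP[j _ xyE]; have [_] := xyP j; rewrite -xyE.
move=> z; rewrite fw wE big_map big_enum /=.
apply: (big_rec2 (fun u v => killing u z = v)) => [|j u v _ uv].
  exact: killing0l.
have [-> _] := xyP j; have := killing_linearl z 1 (lie (xy j).2 (xy j).1) u.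
by rewrite scale1r mul1r uv killing_lie.
Qed.

Lemma homogeneous_killing_neq0 : exists s x y,
  [/\ homogeneous s x, homogeneous (- s) y & killing y x != 0].
Proof.
apply: contrapT => noxy; have [x [y /eqP[]]] := killing_neq0.
have kDr u v z : killing z (u + v) = killing z u + killing z v :> k.
  by have := killing_linearr z 1 u v; rewrite scale1r mul1r.
have k0r z : killing z 0 = 0 :> k by rewrite killingC killing0l.
have k_comp s t : killing (component s y) (component t x) = 0.
  have [st|st] := eqVneq (eta ^ (t + s)) 1; last first.
    apply: (killing_homogeneous (component_homogeneous _ _) (component_homogeneous _ _)).
    by rewrite addrC.
  apply/eqP/negPn/negP => kn; apply: noxy.
  exists t, (component t x), (component s y); split=> //.
    exact: component_homogeneous.
  apply: homogeneous_mod (component_homogeneous s y).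
  by rewrite -[RHS]mulr1 -st -expfzDr// addKr.
rewrite [x]component_sum; apply: (big_ind (fun u => killing u y = 0)) => [|u v u0 v0|t _].
- exact: killing0l.
- by rewrite killingC kDr ![killing y _]killingC u0 v0 addr0.
rewrite killingC [y in killing y]component_sum.
apply: (big_ind (fun u => killing u _ = 0)) => [|u v u0 v0|s _]; first exact: killing0l.
  by rewrite killingC kDr ![killing (component _ _) _]killingC u0 v0 addr0.
exact: k_comp.
Qed.
End Grading.

(** * Partial derivatives and ideals stable under them *)
Lemma linear_for_zero (k : fieldType) (V : lmodType k) (f : V -> k) :
  linear_for *%R f -> f 0 = 0.
Proof. by move=> fl; have := fl (-1) 0 0; rewrite scaler0 addr0 mulN1r addNr. Qed.

Section PartialDerivatives.
Variables (k : fieldType) (V : lmodType k) (S : comAlgType k) (i : {linear V -> S}).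
Hypothesis SP : is_symmetric_algebra i.
Implicit Types f : V -> k.

(** The derivation of $S$ that extends the linear form $f$ on $V$; it is the
    zero map when $f$ is not linear. *)
Definition partial f : S -> S :=
  xget (fun=> 0) [set D | derivation D /\ forall x, D (i x) = (f x)%:A].

Lemma partialP f : linear_for *%R f ->
  derivation (partial f) /\ forall x, partial f (i x) = (f x)%:A.
Proof.
move=> fl; rewrite /partial; case: xgetP => [D _ //|noD].
have [a x y|D DP] := @derivation_exists _ _ _ _ SP (fun x => (f x)%:A).
  by rewrite fl scalerDl scalerA.
by case: (noD D).
Qed.

Lemma partial_der f : linear_for *%R f -> derivation (partial f).
Proof. by case/partialP. Qed.
Lemma partial_gen f x : linear_for *%R f -> partial f (i x) = (f x)%:A.
Proof. by case/partialP. Qed.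

Lemma derivation_lincomb I (r : seq I) (a : I -> S) (D : I -> S -> S) :
  (forall j, derivation (D j)) -> derivation (fun u => \sum_(j <- r) a j * D j u).
Proof.
move=> dD; split=> [b u v|u v].
  rewrite scaler_sumr -big_split; apply: eq_bigr => j _ /=.
  by rewrite (der_linearP (dD j)) mulrDr scalerAr.
rewrite mulr_suml mulr_sumr -big_split; apply: eq_bigr => j _ /=.
by rewrite (derM (dD j)); move: (D j u) (D j v) => x y; ring.
Qed.

Lemma partial_lincomb I (r : seq I) (a : I -> k) (F : I -> V -> k) f P :
  linear_for *%R f -> (forall j, linear_for *%R (F j)) ->
  (forall x, f x = \sum_(j <- r) a j * F j x) ->
  partial f P = \sum_(j <- r) a j *: partial (F j) P.
Proof.
move=> fl Fl fF.
under eq_bigr => j _ do rewrite -mulr_algl.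
move: P; apply: (derivation_eq SP); first exact: partial_der.
  by apply: derivation_lincomb => j; apply: partial_der.
move=> x; rewrite partial_gen// fF scaler_suml; apply: eq_bigr => j _.
by rewrite partial_gen// -[_%:A * _]scalerAl mul1r scalerA.
Qed.

Lemma partial0 f P : (forall x, f x = 0) -> partial f P = 0.
Proof.
move=> f0; have fl : linear_for *%R f by move=> a x y; rewrite !f0 mulr0 addr0.
rewrite (@partial_lincomb _ [::] (fun=> 0) (fun _ : void => f) f P fl)//.
  by rewrite big_nil.
by move=> x; rewrite big_nil f0.
Qed.

End PartialDerivatives.

Section StableIdeals.
Variables (k : fieldType) (V : lmodType k) (S : comAlgType k) (i : {linear V -> S}).
Hypothesis char0 : [pchar k] =i pred0.
Hypothesis SP : is_symmetric_algebra i.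
Variables (c : V) (cp : V -> k).
Hypothesis cp_c : cp c = 1.

(** Degree at most $n$ in the variables other than $c$: elements of $\Bbbk[c]$
    have degree 0. *)
Inductive filtered : nat -> S -> Prop :=
| filtered_const p : filtered 0 (horner_alg (i c) p)
| filteredD n u v : filtered n u -> filtered n v -> filtered n (u + v)
| filteredS n u : filtered n u -> filtered n.+1 u
| filteredM n x u : filtered n u -> filtered n.+1 (i x * u).

Lemma filtered_le m n u : (m <= n)%N -> filtered m u -> filtered n u.
Proof.
by move=> /subnK <- fu; elim: (n - m)%N => // l; exact: filteredS.
Qed.

Lemma filtered_hornerM n p u : filtered n u -> filtered n (horner_alg (i c) p * u).
Proof.
elim=> {n u} [q|n u v _ pu _ pv|n u _ pu|n x u _ pu].
- by rewrite -rmorphM; exact: filtered_const.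
- by rewrite mulrDr; exact: filteredD.
- exact: filteredS.
- by rewrite mulrCA; exact: filteredM.
Qed.

Lemma filtered_mul m n u v : filtered m u -> filtered n v -> filtered (m + n) (u * v).
Proof.
move=> fu fv; elim: fu => {m u} [q|m u w _ pu _ pw|m u _ pu|m x u _ pu].
- exact: filtered_hornerM.
- by rewrite mulrDl; exact: filteredD.
- exact: filteredS.
- by rewrite -mulrA; exact: filteredM.
Qed.

Lemma filteredZ n a u : filtered n u -> filtered n (a *: u).
Proof. by move=> /(filtered_hornerM a%:P); rewrite horner_algC mulr_algl. Qed.

Lemma filtered0P u : filtered 0 u -> exists p, u = horner_alg (i c) p.
Proof.
suff f0 n : filtered n u -> n = 0%N -> exists p, u = horner_alg (i c) p by move/f0; apply.
elim=> {n u} [p||//|//]; first by exists p.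
move=> n u v _ pu _ pv n0; have [[p ->] [q ->]] := (pu n0, pv n0).
by exists (p + q); rewrite rmorphD.
Qed.

Lemma filtered_ex u : exists n, filtered n u.
Proof.
move: u; apply: (symmetric_algebra_ind SP) => [|a u v [m fu] [n fv]|u v [m fu] [n fv]|x].
- by exists 0%N; rewrite -(rmorph1 (horner_alg (i c))); exact: filtered_const.
- exists (m + n)%N; apply: filteredD.
    by apply/filteredZ/(filtered_le _ fu)/leq_addr.
  by apply: (filtered_le _ fv); exact: leq_addl.
- by exists (m + n)%N; exact: filtered_mul.
- exists 1%N; rewrite -[i x]mulr1 -(rmorph1 (horner_alg (i c))).
  exact/filteredM/filtered_const.
Qed.

(** In what follows [E] is the Euler derivation for a complement of the line
    spanned by $c$. *)
Variable E : S -> S.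
Hypothesis E_der : derivation E.
Hypothesis E_gen : forall x, E (i x) = i (x - cp x *: c).

Lemma euler_c : E (i c) = 0.
Proof. by rewrite E_gen cp_c scale1r subrr raddf0. Qed.

(** On the associated graded algebra of the filtration, $E$ is multiplication by
    the degree. *)
Lemma euler_filtered n u : filtered n u -> filtered n.-1 (E u - u *+ n).
Proof.
elim=> {n u} [q|n u v _ pu _ pv|n u fu pu|n x u fu pu].
- rewrite (der_horner E_der) ?euler_c// mulr0n subr0.
  by rewrite -(rmorph0 (horner_alg (i c))); exact: filtered_const.
- rewrite (derDD E_der) mulrnDl opprD addrACA; exact: filteredD.
- rewrite mulrSr opprD addrA /=; apply: filteredD.
    by apply: filtered_le pu; exact: leq_pred.
  by rewrite -scaleN1r; exact: filteredZ.
have iE : i (x - cp x *: c) = i x - cp x *: i c by rewrite linearB linearZ.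
rewrite (derM E_der) E_gen iE mulrBl -addrA.
have -> : i x * u - ((cp x *: i c) * u) + (i x * E u - (i x * u) *+ n.+1) =
  - cp x *: (i c * u) + i x * (E u - u *+ n).
  rewrite scaleNr -scalerAl mulrBr mulrSr -mulrnAr; move: (_ *: _) => y.
  by ring.
apply: filteredD.
  apply: filteredZ; rewrite -(horner_algX (i c)); exact: filtered_hornerM.
case: n fu pu => [|n] fu pu; last by apply: filteredM.
have [p ->] := filtered0P fu.
rewrite (der_horner E_der) ?euler_c// mulr0n subr0 mulr0.
by rewrite -(rmorph0 (horner_alg (i c))); exact: filtered_const.
Qed.

Lemma partial_filtered f n u : linear_for *%R f -> f c = 0 -> filtered n u ->
  filtered n.-1 (partial i f u) /\ (n = 0%N -> partial i f u = 0).
Proof.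
move=> fl fc; have dD := partial_der SP fl.
have Dc : partial i f (i c) = 0 by rewrite partial_gen// fc scale0r.
elim=> {n u} [q|n u v _ [pu u0] _ [pv v0]|n u fu [pu _]|n x u fu [pu u0]].
- rewrite (der_horner dD)//; split=> //.
  by rewrite -(rmorph0 (horner_alg (i c))); exact: filtered_const.
- rewrite (derDD dD); split; first exact: filteredD.
  by move=> n0; rewrite u0// v0// addr0.
- by split=> //; apply: filtered_le pu; exact: leq_pred.
split=> //=; rewrite (derM dD) partial_gen// mulr_algl; apply: filteredD.
  exact: filteredZ.
case: n fu pu u0 => [|n] fu pu u0; last exact: filteredM.
rewrite u0// mulr0.
by rewrite -(rmorph0 (horner_alg (i c))); exact: filtered_const.
Qed.

(** The second hypothesis is Euler's identity: $E u$ is a combination of partial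
    derivatives of $u$. If $u \in J$ has degree $n + 1$, both $E u$ and
    $E u - (n + 1) u$ are in $K$ by induction, because the derivatives of $u$
    and the latter element are in $J$ and of smaller degree. Applied to $K = 0$
    and $K = (c - \lambda)$, this says how far $J$ is determined by
    $J \cap \Bbbk[c]$. *)
Lemma stable_ideal_sub (F : (V -> k) -> Prop) (J K : set S) :
  (forall f, F f -> linear_for *%R f /\ f c = 0) ->
  (forall u (M : set S), ideal M -> (forall f, F f -> M (partial i f u)) -> M (E u)) ->
  ideal J -> ideal K ->
  (forall f u, F f -> J u -> J (partial i f u)) ->
  (forall p, J (horner_alg (i c) p) -> K (horner_alg (i c) p)) ->
  forall u, J u -> K u.
Proof.
move=> Flin FE idJ idK FJ JK u; have [n] := filtered_ex u.
elim: n u => [|n IHn] u fu Ju; first by have [p up] := filtered0P fu; rewrite up in Ju *; exact: JK.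
have KE : K (E u).
  apply: FE => // f Ff; have [fl fc] := Flin f Ff.
  by apply: IHn; [case: (partial_filtered fl fc fu) | exact: FJ].
have KEn : K (E u - u *+ n.+1).
  apply: IHn; first exact: (euler_filtered fu).
  apply: idealB => //; last exact: idealMn.
  by apply: FE => // f Ff; exact: FJ.
apply: (idealMn_inv char0 (n := n)) => //.
by have := idealB idK KE KEn; rewrite opprB addrC subrK.
Qed.
End StableIdeals.

(** * Poisson ideals of the symmetric algebra of a current algebra *)
Lemma lieMzr (k : fieldType) (L : lieAlgType k) (x y : L) n : lie x (y *~ n) = lie x y *~ n.
Proof. exact: raddfMz. Qed.

(** The two algebras $L$ and $L'$ are treated at once through what they have in
    common: loop elements [T e x], for $x t^e$, a central element, an element
    [delta] which is $d$ in $L$ and $0$ in $L'$, and the coordinates [crd e],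
    [cp], [dp] of an element along them. *)
Section CurrentAlgebra.
Variables (k : fieldType) (char0 : [pchar k] =i pred0) (g : finLieAlgType k).
Variables (sigma : {linear g -> g}) (r : nat) (eta : k).
Hypothesis sigma_lie : Lie_endomorphism sigma.
Hypothesis r_gt0 : (0 < r)%N.
Hypothesis sigma_r : iter r sigma =1 id.
Hypothesis eta_prim : r.-primitive_root eta.
Hypothesis simple_g : simple_Lie g.
Hypothesis killing_neq0 : exists x y : g, killing x y != 0.
Local Notation hom := (homogeneous sigma eta).
Local Notation component := (component sigma r eta).

Variables (nu : k) (V : lieAlgType k) (c delta : V) (T : int -> g -> V).
Variables (cp dp : V -> k) (crd : int -> V -> g).
Hypothesis nu_neq0 : nu != 0.
Hypothesis T_linear : forall e, linear (T e).
Hypothesis cp_linear : linear_for *%R cp.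
Hypothesis dp_linear : linear_for *%R dp.
Hypothesis crd_linear : forall e, linear (crd e).
Hypothesis cp_c : cp c = 1.
Hypothesis dp_c : dp c = 0.
Hypothesis crd_c : forall e, crd e c = 0.
Hypothesis crd_hom : forall e X, hom e (crd e X).
Hypothesis lie_c : forall X, lie X c = 0.
Hypothesis lie_T : forall a b x y, hom a x -> hom b y ->
  lie (T a x) (T b y) =
  T (a + b) (lie x y) + (if a + b == 0 then (nu * killing x y) *~ a else 0) *: c.
Hypothesis delta_alt : (forall X, dp X = 0) \/
  (forall a x, hom a x -> lie delta (T a x) = T a x *~ a).
Hypothesis expand : forall X, exists R0 : seq int,
  (forall e, e \notin R0 -> crd e X = 0) /\
  forall R, uniq R -> {subset R0 <= R} ->
    X = cp X *: c + dp X *: delta + \sum_(e <- R) T e (crd e X).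

Variables (S : poissonAlgType k) (i : {linear V -> S}).
Hypothesis SP : is_symmetric_poisson i.
Let SA : is_symmetric_algebra i := SP.1.
Let lie_i x y : lie (i x) (i y) = i (lie x y). Proof. exact: SP.2. Qed.

Local Notation n := (\dim {:g}).
(** The coordinates on the graded piece of degree $e$ come from a basis of the
    whole of $\mathfrak g$, projected to that piece; they are redundant, but
    still express every element in terms of the corresponding vectors. *)
Definition coordinate (e : int) (j : 'I_n) (X : V) : k := coord (vbasis {:g}) j (crd e X).
Definition coordinate_vector (e : int) (j : 'I_n) : V := T e (component e (vbasis {:g})`_j).

Lemma linear_crd (f : g -> k) e : linear_for *%R f -> linear_for *%R (f \o crd e).
Proof. by move=> fl a X Y; rewrite /= crd_linear fl. Qed.

Lemma coordinate_linear e j : linear_for *%R (coordinate e j).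
Proof. by move=> a X Y; rewrite /coordinate crd_linear linearP. Qed.

Lemma partial_support P : exists R0 : seq int, forall e f, linear_for *%R f ->
  e \notin R0 -> partial i (f \o crd e) P = 0.
Proof.
move: P; apply: (symmetric_algebra_ind SA).
- by exists [::] => e f fl _; rewrite (der1 (partial_der SA (linear_crd e fl))).
- move=> a u v [Ru uP] [Rv vP]; exists (Ru ++ Rv) => e f fl.
  rewrite mem_cat negb_or => /andP[/(uP _ _ fl) u0 /(vP _ _ fl) v0].
  by rewrite (der_linearP (partial_der SA (linear_crd e fl))) u0 v0 scaler0 addr0.
- move=> u v [Ru uP] [Rv vP]; exists (Ru ++ Rv) => e f fl.
  rewrite mem_cat negb_or => /andP[/(uP _ _ fl) u0 /(vP _ _ fl) v0].
  by rewrite (derM (partial_der SA (linear_crd e fl))) u0 v0 mul0r mulr0 addr0.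
- move=> X; have [R0 [X0 _]] := expand X; exists R0 => e f fl /X0 eX.
  by rewrite (partial_gen SA _ (linear_crd e fl)) /= eX linear_for_zero// scale0r.
Qed.

(** Both sides are derivations in $P$ for a fixed large enough range of degrees,
    so it suffices to compare them on generators. *)
Lemma chain_rule P : exists R0 : seq int, forall R, uniq R -> {subset R0 <= R} ->
  forall D : S -> S, derivation D -> D (i c) = 0 ->
  D P = partial i dp P * D (i delta) +
    \sum_(e <- R) \sum_j partial i (coordinate e j) P * D (i (coordinate_vector e j)).
Proof.
have cl := coordinate_linear; have pd := partial_der SA.
move: P; apply: (symmetric_algebra_ind SA).
- exists [::] => R _ _ D dD _; rewrite (der1 dD) (der1 (pd _ dp_linear)) mul0r add0r.
  by rewrite big1// => e _; rewrite big1// => j _; rewrite (der1 (pd _ (cl e j))) mul0r.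
- move=> a u v [Ru uP] [Rv vP]; exists (Ru ++ Rv) => R uniqR RR D dD Dc.
  have RuR : {subset Ru <= R} by move=> e eR; apply: RR; rewrite mem_cat eR.
  have RvR : {subset Rv <= R} by move=> e eR; apply: RR; rewrite mem_cat eR orbT.
  rewrite (der_linearP dD) (uP R uniqR RuR D dD Dc) (vP R uniqR RvR D dD Dc).
  rewrite (der_linearP (pd _ dp_linear)) mulrDl -scalerAl scalerDr addrACA.
  rewrite scaler_sumr -big_split /=; congr (_ + _); apply: eq_bigr => e _.
  rewrite scaler_sumr -big_split /=; apply: eq_bigr => j _.
  by rewrite (der_linearP (pd _ (cl e j))) mulrDl -scalerAl.
- move=> u v [Ru uP] [Rv vP]; exists (Ru ++ Rv) => R uniqR RR D dD Dc.
  have RuR : {subset Ru <= R} by move=> e eR; apply: RR; rewrite mem_cat eR.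
  have RvR : {subset Rv <= R} by move=> e eR; apply: RR; rewrite mem_cat eR orbT.
  rewrite (derM dD) (uP R uniqR RuR D dD Dc) (vP R uniqR RvR D dD Dc).
  rewrite (derM (pd _ dp_linear)) mulrDl mulrDr addrACA; congr (_ + _).
    by move: (partial _ _ _) (D _) => x y; ring.
  rewrite mulr_suml mulr_sumr -big_split /=; apply: eq_bigr => e _.
  rewrite mulr_suml mulr_sumr -big_split /=; apply: eq_bigr => j _.
  by rewrite (derM (pd _ (cl e j))); move: (partial _ _ _) (partial _ _ _) (D _) => x y z; ring.
move=> X; have [R0 [_ XE]] := expand X; exists R0 => R uniqR RR D dD Dc.
rewrite {1}(XE R uniqR RR) !linearD /= !linearZ /= linear_sum.
rewrite !(derDD dD) !(derZ dD) Dc scaler0 add0r (der_sum dD).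
rewrite (partial_gen SA _ dp_linear) mulr_algl; congr (_ + _).
apply: eq_bigr => e _.
transitivity (\sum_j coordinate e j X *: D (i (coordinate_vector e j))); last first.
  by apply: eq_bigr => j _; rewrite (partial_gen SA _ (cl e j)) mulr_algl.
pose h z := D (i (T e (component e z))).
have h_lin : linear h.
  by move=> a x y; rewrite /h component_linear T_linear linearP (der_linearP dD).
have -> : D (i (T e (crd e X))) = h (crd e X).
  by rewrite /h (component_id char0 r_gt0 eta_prim (crd_hom e X)).
pose hL : {linear g -> S} := HB.pack h
  (GRing.isSemilinear.Build k g S _ h (GRing.semilinear_linear h_lin)).
rewrite -[h]/(hL : g -> S) [crd e X in LHS](coord_vbasis (memvf _)) linear_sum.
by apply: eq_bigr => j _; rewrite linearZ.
Qed.

Lemma partial_data P : exists R : seq int, [/\ uniq R,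
  forall e f, linear_for *%R f -> e \notin R -> partial i (f \o crd e) P = 0 &
  forall D : S -> S, derivation D -> D (i c) = 0 ->
  D P = partial i dp P * D (i delta) +
    \sum_(e <- R) \sum_j partial i (coordinate e j) P * D (i (coordinate_vector e j))].
Proof.
have [R1 R1P] := partial_support P; have [R2 R2P] := chain_rule P.
exists (undup (R1 ++ R2)); split; first exact: undup_uniq.
  move=> e f fl; rewrite mem_undup mem_cat negb_or => /andP[eR _]; exact: R1P.
by apply: R2P; [exact: undup_uniq | move=> e eR; rewrite mem_undup mem_cat eR orbT].
Qed.

Variable J : set S.
Hypothesis PJ : poisson_ideal J.
Hypothesis radJ : forall a m, J (a ^+ m) -> J a.
Hypothesis satJ : forall a, J (i c * a) -> J a.
Let idJ := poisson_ideal_ideal PJ.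

Lemma lie_ic (x : V) : lie (i x) (i c) = 0.
Proof. by rewrite lie_i lie_c raddf0. Qed.

(** Expand $\{v, \{u, P\}\} \in J$ by the chain rule. *)
Lemma bracket_finite_rank P (u v : int -> V) (I : Type) (s : seq I) (p : I -> S) (z : I -> V) :
  J P -> (forall D, derivation D -> D (i c) = 0 -> D P = \sum_(j <- s) p j * D (i (z j))) ->
  finite_rank J (fun a b => \sum_(j <- s) p j * i (lie (v b) (lie (u a) (z j)))).
Proof.
move=> JP DP; have [_ _ _ Jlie] := PJ.
exists [seq ((fun a => - i (lie (u a) (z j))), (fun b => lie (i (v b)) (p j))) | j <- s].
move=> a b; have := Jlie (i (v b)) _ (Jlie (i (u a)) _ JP).
have du x := lie_derivation (i x).
rewrite (DP (lie (i (u a))) (du _) (lie_ic _)) (der_sum (du _)) big_map /= -sumrB.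
congr J; apply: eq_bigr => j _; rewrite (derM (du _)) !lie_i.
by rewrite mulNr opprK addrC [i _ * _]mulrC.
Qed.

Lemma homogeneous_shift s a x : hom s x -> hom (s + r%:Z * a) x.
Proof.
apply: homogeneous_mod; rewrite expfzDr ?(expz_prim_mul eta_prim) ?mulr1//.
exact: prim_root_neq0 r_gt0 eta_prim.
Qed.

Definition bracket_const (s t e : int) (x y z : g) (m : int) : S :=
  i (T (s + t + e + r%:Z * m) (lie y (lie x z))) +
  (if s + t + e + r%:Z * m == 0 then (nu * killing y (lie x z)) *~ t else 0) *: i c.
Definition bracket_slope (s t e : int) (x y z : g) (m : int) : S :=
  (if s + t + e + r%:Z * m == 0 then (nu * killing y (lie x z)) *~ r%:Z else 0) *: i c.

(** Only the cocycle term depends on $b$ once $a + b$ is given: it carries the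
    degree $t + rb$ of the outer factor. *)
Lemma double_bracket s t e x y z a b : hom s x -> hom t y -> hom e z ->
  i (lie (T (t + r%:Z * b) y) (lie (T (s + r%:Z * a) x) (T e z))) =
  bracket_const s t e x y z (a + b) + bracket_slope s t e x y z (a + b) *~ b.
Proof.
move=> hx hy hz; rewrite (lie_T (homogeneous_shift a hx) hz) lieDr lieZr lie_c scaler0 addr0.
have hxz := homogeneous_lie sigma_lie r_gt0 eta_prim (homogeneous_shift a hx) hz.
rewrite (lie_T (homogeneous_shift b hy) hxz).
have -> : t + r%:Z * b + (s + r%:Z * a + e) = s + t + e + r%:Z * (a + b) by ring.
rewrite /bracket_const /bracket_slope linearD linearZ /= -[RHS]addrA; congr (_ + _).
case: eqP => _; last by rewrite !scale0r mul0rz addr0.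
by rewrite scalerMzl -scalerDl mulrzDr mulrzA.
Qed.

(** Here both brackets contribute a degree, $s + ra$ from $d$ and $-s + rb$ from
    the cocycle, and with $a = - b$ their product has leading term $- r^2 b^2$. *)
Lemma delta_bracket s x y a b :
  (forall e x, hom e x -> lie delta (T e x) = T e x *~ e) ->
  hom s x -> hom (- s) y ->
  i (lie (T (- s + r%:Z * b) y) (lie (T (s + r%:Z * a) x) delta)) =
  (i (T (r%:Z * (a + b)) (lie y x)) *~ - (s + r%:Z * (a + b))
     + ((if a + b == 0 then (nu * killing y x) *~ (s * s) else 0) *: i c)) +
  (i (T (r%:Z * (a + b)) (lie y x)) *~ r%:Z
     - ((if a + b == 0 then (nu * killing y x) *~ (2 * s * r%:Z) else 0) *: i c)) *~ b
  + ((if a + b == 0 then (nu * killing y x) *~ (r%:Z * r%:Z) else 0) *: i c) *~ (b * b).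
Proof.
move=> lie_d hx hy; rewrite [lie _ delta]lieC lie_d; last exact: homogeneous_shift.
rewrite linearN /= lieMzr (lie_T (homogeneous_shift b hy) (homogeneous_shift a hx)).
have -> : - s + r%:Z * b + (s + r%:Z * a) = r%:Z * (a + b) by ring.
have -> : (r%:Z * (a + b) == 0) = (a + b == 0).
  by rewrite mulf_eq0 eqz_nat eqn0Ngt r_gt0.
have -> : i (- ((T (r%:Z * (a + b)) (lie y x) + (if a + b == 0 then (nu * killing y x) *~
    (- s + r%:Z * b) else 0) *: c) *~ (s + r%:Z * a))) =
    - ((i (T (r%:Z * (a + b)) (lie y x)) + (if a + b == 0 then (nu * killing y x) *~
    (- s + r%:Z * b) else 0) *: i c) *~ (s + r%:Z * a)).
  have iE A q : i (A + q *: c) = i A + q *: i c by rewrite linearD linearZ.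
  by rewrite (raddfN i) (raddfMz i) /= iE.
move: (i (T _ _)) => w.
have cE m : (if a + b == 0 then (nu * killing y x) *~ m else 0) *: i c =
    if a + b == 0 then ((nu * killing y x) *: i c) *~ m else 0.
  by case: ifP => _; rewrite ?scale0r ?scalerMzl.
rewrite !cE; move: (_ *: i c) => u.
have wE : - (w *~ (s + r%:Z * a)) = w *~ - (s + r%:Z * (a + b)) + w *~ r%:Z *~ b.
  by rewrite -mulrzA -mulrzDr -mulrNz; congr (_ *~ _); ring.
have -> (v : S) : - ((w + v) *~ (s + r%:Z * a)) =
    w *~ - (s + r%:Z * (a + b)) + w *~ r%:Z *~ b - v *~ (s + r%:Z * a).
  by rewrite mulrzDl opprD wE.
case: eqP => [ab0|_]; last by rewrite !mul0rz !subr0 !addr0.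
have -> : a = - b by lia.
have -> : - (u *~ (- s + r%:Z * b) *~ (s + r%:Z * - b)) =
    u *~ (s * s) - u *~ (2 * s * r%:Z) *~ b + u *~ (r%:Z * r%:Z) *~ (b * b).
  by rewrite -!mulrzA -!mulrNz -!mulrzDr; congr (_ *~ _); ring.
rewrite addNr mulr0 mulrzDl mulNrz.
by move: (w *~ - _) (w *~ _ *~ _) (u *~ _) (u *~ _ *~ _) (u *~ _ *~ _) => w1 w2 u1 u2 u3; ring.
Qed.

Definition coordinate_data (P : S) (R : seq int) : Prop :=
  forall D : S -> S, derivation D -> D (i c) = 0 ->
  D P = partial i dp P * D (i delta) +
    \sum_(e <- R) \sum_j partial i (coordinate e j) P * D (i (coordinate_vector e j)).

Lemma coordinate_finite_rank P R (u v : int -> V) : J P -> coordinate_data P R ->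
  finite_rank J (fun a b => partial i dp P * i (lie (v b) (lie (u a) delta)) +
    \sum_(e <- R) \sum_j
      partial i (coordinate e j) P * i (lie (v b) (lie (u a) (coordinate_vector e j)))).
Proof.
move=> JP DP.
pose s : seq (option (int * 'I_n)) :=
  None :: [seq Some (e, j) | e <- R, j <- index_enum 'I_n].
pose p o := if o is Some (e, j) then partial i (coordinate e j) P else partial i dp P.
pose z o := if o is Some (e, j) then coordinate_vector e j else delta.
have sE (F : V -> S) : \sum_(o <- s) p o * F (z o) = partial i dp P * F delta +
    \sum_(e <- R) \sum_j partial i (coordinate e j) P * F (coordinate_vector e j).
  by rewrite big_cons big_allpairs_dep.
have := @bracket_finite_rank P u v _ s p z JP.
have -> : (fun a b => \sum_(o <- s) p o * i (lie (v b) (lie (u a) (z o)))) =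
  (fun a b => partial i dp P * i (lie (v b) (lie (u a) delta)) + \sum_(e <- R) \sum_j
      partial i (coordinate e j) P * i (lie (v b) (lie (u a) (coordinate_vector e j)))).
  by apply/funext => a; apply/funext => b; rewrite (sE (fun X => i (lie (v b) (lie (u a) X)))).
by apply=> D dD Dc; rewrite (DP D dD Dc) (sE (fun X => D (i X))).
Qed.

Definition coordinate_sum P R (G : int -> 'I_n -> int -> S) (m : int) : S :=
  \sum_(e <- R) \sum_j partial i (coordinate e j) P * G e j m.

Lemma coordinate_sum_bracket P R s t x y a b : hom s x -> hom t y ->
  \sum_(e <- R) \sum_j partial i (coordinate e j) P *
    i (lie (T (t + r%:Z * b) y) (lie (T (s + r%:Z * a) x) (coordinate_vector e j))) =
  coordinate_sum P R (fun e j => bracket_const s t e x y (component e (vbasis {:g})`_j)) (a + b) +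
  coordinate_sum P R (fun e j => bracket_slope s t e x y (component e (vbasis {:g})`_j)) (a + b) *~ b.
Proof.
move=> hx hy; rewrite /coordinate_sum mulrz_suml -big_split; apply: eq_bigr => e _ /=.
rewrite mulrz_suml -big_split; apply: eq_bigr => j _ /=.
rewrite double_bracket//; last exact: component_homogeneous.
by rewrite mulrDr mulrzAr.
Qed.

Lemma quadratic_split (D w0 w1 w2 z0 z1 : S) (b : int) :
  D * (w0 + w1 *~ b + w2 *~ (b * b)) + (z0 + z1 *~ b) -
  (D * w0 + z0 + (D * w1 + z1) *~ b + D * w2 *~ (b * b)) = 0.
Proof.
rewrite mulrzDl -!mulrzAr.
by move: (w1 *~ b) (w2 *~ (b * b)) (z1 *~ b) => a1 a2 a3; ring.
Qed.

(** The coefficient of $b^2$ is $r^2 \nu \kappa(y, x) c \, \partial P / \partial d$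
    when $a + b = 0$, and zero otherwise. *)
Lemma partial_d_stable P : J P -> J (partial i dp P).
Proof.
move=> JP; have [dp0|lie_d] := delta_alt; first by rewrite (partial0 SA)//; exact: ideal0.
have [R [uniqR _ DP]] := partial_data P.
have [s [x [y [hx hy kxy]]]] := homogeneous_killing_neq0 char0 sigma_lie r_gt0 sigma_r eta_prim killing_neq0.
have := coordinate_finite_rank (fun a => T (s + r%:Z * a) x) (fun b => T (- s + r%:Z * b) y) JP DP.
set D := partial i dp P => rk.
pose F2 (m : int) := D * ((if m == 0 then (nu * killing y x) *~ (r%:Z * r%:Z) else 0) *: i c).
have J2 a : J (a *+ 2) -> J a by apply: idealMn_inv.
have : J (F2 0).
  pose F0 (m : int) := D * (i (T (r%:Z * m) (lie y x)) *~ - (s + r%:Z * m)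
     + ((if m == 0 then (nu * killing y x) *~ (s * s) else 0) *: i c)) +
     coordinate_sum P R (fun e j => bracket_const s (- s) e x y (component e (vbasis {:g})`_j)) m.
  pose F1 (m : int) := D * (i (T (r%:Z * m) (lie y x)) *~ r%:Z
     - ((if m == 0 then (nu * killing y x) *~ (2 * s * r%:Z) else 0) *: i c)) +
     coordinate_sum P R (fun e j => bracket_slope s (- s) e x y (component e (vbasis {:g})`_j)) m.
  apply: (@hankel_quadratic _ _ idJ radJ F0 F1 F2 0) => // [|m m0]; last first.
    by rewrite /F2 gt_eqF// scale0r mulr0; exact: ideal0.
  apply: finite_rank_congr rk => // a b.
  rewrite coordinate_sum_bracket// delta_bracket// /F0 /F1 /F2.
  by rewrite (_ : _ - _ = 0); [exact: ideal0 | exact: quadratic_split].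
rewrite /F2 eqxx -scalerAr => /idealZ_inv Jc; apply: satJ; rewrite mulrC; apply: Jc => //.
rewrite -mulrzr !mulf_neq0// intrM mulf_neq0//.
all: by have /pcharf0P -> := char0; rewrite -lt0n.
Qed.

Lemma killing_lie_linear x y : linear_for *%R (fun z : g => killing y (lie x z)).
Proof. by move=> a u v; rewrite linearP killing_linearr. Qed.

Lemma seq_int_bounded (R : seq int) : exists B : nat, forall e, e \in R -> - B%:Z <= e.
Proof.
elim: R => [|e R [B RB]]; first by exists 0%N.
exists (B + `|e|)%N => e'; rewrite inE => /predU1P[->|/RB]; lia.
Qed.

(** Modulo $J$ the $d$-derivative drops out, and the slopes add up to
    $r \nu c$ times the derivative in question, for the value $- a$ of the index
    such that $s + t + e = r a$. When $s + t + e$ is not a multiple of $r$ the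
    functional vanishes on the graded piece of degree $e$. *)
Lemma partial_killing_stable P e s t x y : J P -> hom s x -> hom t y ->
  J (partial i ((fun z => killing y (lie x z)) \o crd e) P).
Proof.
move=> JP hx hy; have kl := killing_lie_linear x y; set f := (fun z => _) in kl *.
have [rste|ste] := eqVneq (eta ^ (t + (s + e))) 1; last first.
  rewrite (partial0 SA); first exact: ideal0.
  move=> X /=; apply: (killing_homogeneous sigma_lie r_gt0 sigma_r eta_prim hy _ ste).
  exact: (homogeneous_lie sigma_lie r_gt0 eta_prim hx (crd_hom e X)).
have [a ea] := expz_prim_eq1 r_gt0 eta_prim rste.
have [R [uniqR suppR DP]] := partial_data P.
have [eR|eR] := boolP (e \in R); last by rewrite suppR//; exact: ideal0.
pose z e (j : 'I_n) := component e (vbasis {:g})`_j.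
pose F0 := coordinate_sum P R (fun e j => bracket_const s t e x y (z e j)).
pose F1 := coordinate_sum P R (fun e j => bracket_slope s t e x y (z e j)).
have [B RB] := seq_int_bounded R.
have JF1 : forall m, J (F1 m).
  apply: (@hankel_affine _ _ idJ radJ F0 F1 (`|s|%N + `|t|%N + B)%:Z) => [|m mB].
    have := coordinate_finite_rank (fun a => T (s + r%:Z * a) x) (fun b => T (t + r%:Z * b) y) JP DP.
    apply: finite_rank_congr => // a' b'; rewrite coordinate_sum_bracket//.
    match goal with |- J (?p + ?q - ?w) => have -> : p + q - w = p by exact: addrK end.
    by apply: ideal_mulr => //; exact: partial_d_stable.
  (* The degrees occurring in P are bounded below, which bounds the support of
     the slopes. *)
  rewrite /F1 /coordinate_sum big_seq big1; first exact: ideal0.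
  move=> e' /RB e'B; rewrite big1// => j _; rewrite /bracket_slope.
  have rm : m <= r%:Z * m by nia.
  by case: eqP => [|_]; [lia | rewrite scale0r mulr0].
have := JF1 (- a); rewrite /F1 /coordinate_sum (bigD1_seq e)//= [X in _ + X]big1 ?addr0; last first.
  move=> e' e'e; rewrite big1// => j _; rewrite /bracket_slope.
  by case: eqP => [|_]; [move/eqP in e'e; lia | rewrite scale0r mulr0].
have psiE X : f (crd e X) = \sum_j f (z e j) * coordinate e j X.
  rewrite -{1}(component_id char0 r_gt0 eta_prim (crd_hom e X)).
  rewrite {1}(coord_vbasis (memvf (crd e X))).
  have fc : linear_for *%R (fun z => f (component e z)).
    by move=> b u v; rewrite component_linear kl.
  elim/big_rec2: _ => [|j u v _ <-]; first exact: (linear_for_zero fc).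
  by rewrite fc mulrC.
rewrite (partial_lincomb SA _ (linear_crd e kl) (coordinate_linear e) psiE).
set Q := \sum_j f (z e j) *: _ => JQ; apply: satJ.
apply: (@idealZ_inv _ _ J (nu * r%:R)) => //.
  by rewrite mulf_neq0//; have /pcharf0P -> := char0; rewrite -lt0n.
congr J: JQ; rewrite /Q mulr_sumr scaler_sumr; apply: eq_bigr => j _.
rewrite /bracket_slope (_ : _ == 0); last by apply/eqP; lia.
rewrite -!scalerAr scalerA [i c * _]mulrC; congr (_ *: _).
rewrite -[LHS]/((nu * f (z e j)) *+ r) -[LHS]mulr_natr.
by move: (f _) (r%:R : k) => u v; ring.
Qed.

Lemma partial_coordinate_stable P e (f : g -> k) :
  J P -> linear_for *%R f -> J (partial i (f \o crd e) P).
Proof.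
move=> JP fl.
have [X [Xhom fX]] := functional_brackets char0 r_gt0 sigma_r eta_prim simple_g killing_neq0 fl.
pose F (xy : g * g) := (fun z => killing xy.2 (lie xy.1 z)) \o crd e.
have Fl xy : linear_for *%R (F xy) by apply/linear_crd/killing_lie_linear.
rewrite (partial_lincomb SA (r := X) (a := fun=> 1) P (linear_crd e fl) Fl); last first.
  by move=> Y; rewrite /= fX; apply: eq_bigr => xy _; rewrite mul1r.
rewrite big_seq; apply: ideal_sum => // -[x y] xyX.
have [s [t [hx hy]]] := Xhom x y xyX.
by apply: idealZ => //; apply: (@partial_killing_stable P e s t x y).
Qed.

Definition coordinate_functional (f : V -> k) : Prop :=
  f = dp \/ exists e h, linear_for *%R h /\ f = (h : g -> k) \o crd e.

Lemma poisson_ideal_from_constants (K : set S) : ideal K ->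
  (forall p, J (horner_alg (i c) p) -> K (horner_alg (i c) p)) -> forall u, J u -> K u.
Proof.
move=> idK JK.
have [|E [dE EP]] := @derivation_exists _ _ _ _ SA (fun x => i (x - cp x *: c)).
  move=> a x y; rewrite -linearP; congr (i _).
  by rewrite cp_linear scalerDl scalerBr scalerA opprD addrACA.
apply: (@stable_ideal_sub _ _ _ i char0 SA c cp cp_c E dE EP coordinate_functional) => //.
- move=> f [->|[e [h [hl ->]]]]; first by rewrite dp_c.
  by split; [exact: linear_crd | rewrite /= crd_c linear_for_zero].
- move=> u M idM Mu; have [R [_ _ DP]] := partial_data u.
  have Ec : E (i c) = 0 by rewrite EP cp_c scale1r subrr raddf0.
  rewrite (DP E dE Ec); apply: idealD => //; first by apply: ideal_mulr => //; apply: Mu; left.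
  apply: ideal_sum => // e _; apply: ideal_sum => // j _; apply: ideal_mulr => //; apply: Mu.
  by right; exists e, (coord (vbasis {:g}) j); split=> // a x y; rewrite linearP.
- move=> f u [->|[e [h [hl ->]]]] Ju; first exact: partial_d_stable.
  exact: partial_coordinate_stable.
Qed.

End CurrentAlgebra.

(** * Polynomials in the central element, and extension of scalars *)
Lemma lrmorph_horner_alg (k : fieldType) (A B : comAlgType k)
  (h : {lrmorphism A -> B}) a p : h (horner_alg a p) = horner_alg (h a) p.
Proof.
elim/poly_ind: p => [|p b IHp]; first by rewrite !rmorph0.
by rewrite !rmorphD !rmorphM /= IHp !horner_algX !horner_algC linearZ /= rmorph1.
Qed.

Lemma horner_alg_scalar (k : fieldType) (A : comAlgType k) (a : k) p :
  horner_alg (a%:A : A) p = (p.[a])%:A.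
Proof.
elim/poly_ind: p => [|p b IHp]; first by rewrite rmorph0 horner0 scale0r.
rewrite rmorphD rmorphM /= IHp horner_algX horner_algC hornerMXaddC.
by rewrite -scalerAl mul1r scalerA scalerDl.
Qed.

Lemma horner_alg_X (k : fieldType) (p : {poly k}) : horner_alg ('X : {poly k}) p = p.
Proof.
elim/poly_ind: p => [|p b IHp]; first by rewrite rmorph0.
by rewrite rmorphD rmorphM /= IHp horner_algX horner_algC alg_polyC.
Qed.

Lemma poisson_ideal_preimage (k k' : fieldType) (S : poissonAlgType k)
  (Q : poissonAlgType k') (q : {rmorphism S -> Q}) (I : set Q) :
  (forall a b, q (lie a b) = lie (q a) (q b)) ->
  poisson_ideal I -> poisson_ideal [set a | I (q a)].
Proof.
move=> q_lie [I0 ID IM Il]; split=> [|a b|a b|a b] /=.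
- by rewrite rmorph0.
- by rewrite rmorphD; exact: ID.
- by rewrite rmorphM; exact: IM.
- by rewrite q_lie; exact: Il.
Qed.

Lemma fraction_numden (R : idomainType) (x : {fraction R}) :
  exists n d : R, d != 0 /\ tofrac d * x = tofrac n.
Proof.
elim/quotW: x => x; exists (frac x).1, (frac x).2; split; first exact: denom_ratioP.
unlock FracField.tofrac; rewrite -[LHS]FracField.pi_mul; apply/eqmodP.
rewrite /= FracField.equivfE /FracField.mulf !numden_Ratio ?mulf_neq0 ?oner_eq0 ?denom_ratioP//.
by rewrite mul1r mulr1 mulrC.
Qed.

(** The elements of this form are a subalgebra of $A$ through which $\varphi$
    factors, so they are everything by the uniqueness part of the universal
    property. *)
Lemma base_change_fraction (k : fieldType) (S : poissonAlgType k) (c : S)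
  (A : comAlgType {fraction {poly k}}) (phi : {rmorphism S -> A}) :
  is_base_change c phi ->
  forall a, exists p s, p != 0 /\ tofrac p *: a = phi s.
Proof.
move=> [phi_c univ].
pose P a := exists p s, p != 0 /\ tofrac p *: a = phi s.
have phiZ p s : tofrac p *: phi s = phi (horner_alg c p * s).
  by rewrite rmorphM phi_c mulr_algl.
pose P' := [pred a | `[< P a >]].
have P'_alg : GRing.subalg_closed P'.
  split=> [|x u v /asboolP[p [s [p0 ps]]] /asboolP[q [t [q0 qt]]]|u v].
  - by apply/asboolP; exists 1, 1; rewrite oner_neq0 !rmorph1 scale1r.
  - apply/asboolP; have [n [d [d0 xd]]] := fraction_numden x.
    exists (d * p * q), (horner_alg c (n * q) * s + horner_alg c (d * p) * t).
    split; first by rewrite !mulf_neq0.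
    rewrite rmorphD -!phiZ -ps -qt scalerDr !scalerA !tofracM -xd.
    move: (tofrac p) (tofrac q) (tofrac d) => p' q' d'.
    by congr (_ *: _ + _); ring.
  - move=> /asboolP[p [s [p0 ps]]] /asboolP[q [t [q0 qt]]]; apply/asboolP.
    exists (p * q), (s * t); rewrite mulf_neq0//; split=> //.
    by rewrite !rmorphM -ps -qt -scalerAl -scalerAr scalerA.
have P'phi s : phi s \in P'.
  by apply/asboolP; exists 1, s; rewrite oner_neq0 rmorph1 scale1r.
pose f s : subalgebra_of P'_alg := Subalgebra (P'phi s).
have f_add : zmod_morphism f by move=> s t; apply/val_inj; rewrite /= rmorphB.
have f_mon : monoid_morphism f.
  by split=> [|s t]; apply/val_inj; rewrite /= ?rmorph1 ?rmorphM.
pose fR : {rmorphism S -> subalgebra_of P'_alg} := HB.pack f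
  (GRing.isZmodMorphism.Build _ _ f f_add) (GRing.isMonoidMorphism.Build _ _ f f_mon).
have f_c : over_kc c fR by move=> p; apply/val_inj; exact: phi_c.
have [h hf _] := univ _ fR f_c; have [h1 _ h1P] := univ _ phi phi_c.
pose vh : {lrmorphism A -> A} := @subalgebra_incl _ _ _ P'_alg \o h.
have vhphi : vh \o phi =1 phi by move=> s; have /= -> := hf s.
have idphi : (idfun : {lrmorphism A -> A}) \o phi =1 phi by [].
move=> a; suff : P a by [].
have -> : a = subalgebra_incl (h a).
  by have /= -> := h1P _ vhphi a; rewrite -(h1P _ idphi a).
exact/asboolP/(valP (h a)).
Qed.

(** * The affine algebras *)

(** A subalgebra $W$ lying between $L'$ and $L$ is one of these two; working with
    $W$ avoids proving everything twice. *)
Section AffineSubalgebra.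
Variables (k : fieldType) (char0 : [pchar k] =i pred0) (D : affineDatum k).
Local Notation g := (aff_g D).
Local Notation sigma := (@aff_sigma k D).
Local Notation eta := (@aff_eta k D).
Local Notation r := (aff_r D).
Local Notation nu := (aff_nu D).
Local Notation hat := (affinization g nu).
Local Notation hom := (homogeneous sigma eta).
Local Notation component := (component sigma r eta).

Let r_gt0 : (0 < r)%N. Proof. by case: (aff_order D). Qed.
Let sigma_r : iter r sigma =1 id. Proof. by case: (aff_order D). Qed.
Let sigma_lie : Lie_endomorphism sigma. Proof. by case: (aff_diag D). Qed.
Let eta_prim := aff_prim D.
Let killing_neq0 : exists x y : g, killing x y != 0.
Proof.
have [_ [n [A [e [f [h [p [che _ _ _ _]]]]]]]] := aff_diag D.
exact: killing_chevalley (aff_simple D) char0 _ _ _ _ _ che.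
Qed.

Variable W : lieSubalgebra hat.
Hypothesis W_affine : forall X, X \in W -> X \in @affine_pred k D.
Hypothesis affine'_W : forall X, X \in @affine'_pred k D -> X \in W.
Hypothesis cW : c_elt g nu \in W.
Local Notation V := (lie_sub W).

Fact current_subproof e x : loop_mono nu e (component e x) \in W.
Proof.
apply: affine'_W; rewrite affine'_predE eqxx andbT; apply/affine_predP => s.
rewrite /= ; case: eqP => [->|_]; last by rewrite linear0 scaler0.
exact: component_homogeneous.
Qed.

Definition current (e : int) (x : g) : V := LieSub (current_subproof e x).
Definition central : V := LieSub cW.
(** The element $d$ if it belongs to $W$, and $0$ otherwise. *)
Definition scaling : V := insubd 0 (d_elt g nu).
Definition loop_coef (e : int) (X : V) : g := loop_part (val X) e.

Lemma current_linear e : linear (current e).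
Proof.
by move=> a x y; apply: val_inj; rewrite /= component_linear loop_mono_linear.
Qed.

Lemma loop_coef_linear e : linear (loop_coef e).
Proof.
by move=> a X Y; rewrite /loop_coef linearP laurentD laurentZ.
Qed.

Lemma loop_coef_hom e X : hom e (loop_coef e X).
Proof. by have /affine_predP := W_affine (valP X); apply. Qed.

Lemma val_current e x : val (current e x) = loop_mono nu e (component e x).
Proof. by []. Qed.

Lemma val_lie (X Y : V) : val (lie X Y) = affinization_lie (val X) (val Y).
Proof. by []. Qed.

Lemma val_lincomb a b (u v w : V) :
  val (a *: u + b *: v + w) = a *: val u + b *: val v + val w.
Proof. exact: erefl. Qed.

Lemma val_sum (R : seq int) (F : int -> V) :
  val (\sum_(e <- R) F e) = \sum_(e <- R) val (F e).
Proof. exact: raddf_sum. Qed.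

Lemma lie_central X : lie X central = 0.
Proof. have cX : lie central X = 0.
  by apply: val_inj; rewrite val_lie [LHS]affinization_lie_c raddf0.
by rewrite lieC cX oppr0. Qed.

Lemma lie_current a b x y : hom a x -> hom b y ->
  lie (current a x) (current b y) = current (a + b) (lie x y) +
  (if a + b == 0 then (nu * killing x y) *~ a else 0) *: central.
Proof.
move=> hx hy; apply: val_inj; rewrite val_lie !val_current affinization_lie_monomial.
have hxy := homogeneous_lie sigma_lie r_gt0 eta_prim hx hy.
rewrite (component_id char0 r_gt0 eta_prim hx) (component_id char0 r_gt0 eta_prim hy).
rewrite [RHS]raddfD; congr (_ + _).
by rewrite [RHS]val_current (component_id char0 r_gt0 eta_prim hxy).
Qed.

(** What remains of $X$ after removing its component along $d$ is in $L'$. *)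
Lemma scaling_mem X : X \in W -> d_part X *: d_elt g nu \in W.
Proof.
move=> XW; have -> : d_part X *: d_elt g nu = X - (X - d_part X *: d_elt g nu).
  by rewrite opprB addrC subrK.
apply: rpredB => //; apply: affine'_W; rewrite affine'_predE; apply/andP; split.
  apply/affine_predP => s; have /affine_predP/(_ s) := W_affine XW.
  by rewrite -[loop_part (X - _)]/(loop_part X - _ *: 0) scaler0 subr0.
by rewrite -[d_part (X - _)]/(d_part X - d_part X * 1) mulr1 subrr.
Qed.

Lemma val_scaling : val scaling = if d_elt g nu \in W then d_elt g nu else 0.
Proof. exact: val_insubd. Qed.

Lemma scaling_alt : (forall X : V, d_part (val X) = 0) \/
  (forall a x, hom a x -> lie scaling (current a x) = current a x *~ a).
Proof.
have [dW|dW] := boolP (d_elt g nu \in W); [right|left] => [a x hx|X].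
  apply: val_inj; rewrite val_lie val_scaling dW val_current affinization_lie_d.
  pose m : {linear g -> hat} := HB.pack (loop_mono nu a)
    (GRing.isSemilinear.Build k g _ _ (loop_mono nu a)
       (GRing.semilinear_linear (loop_mono_linear nu a))).
  rewrite -[LHS]/(m _) raddfMz (raddfMz val).
  by [].
apply/eqP/negPn/negP => dX; case/negP: dW.
have := scaling_mem (valP X) => /(@rpredZ _ _ (lie_sub_mem W) (d_part (val X))^-1).
by rewrite scalerA mulVf// scale1r.
Qed.

Lemma laurent_sum (R : seq int) (f : laurent g) : uniq R ->
  (forall e, e \notin R -> f e = 0) -> f = \sum_(e <- R) monomial e (f e).
Proof.
move=> uR fR; apply/laurentP => s.
rewrite (big_morph (fun h : laurent g => h s) (id1 := 0) (op1 := +%R))//.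
under eq_bigr do rewrite monomialE.
have [sR|sR] := boolP (s \in R); last first.
  by rewrite fR// big_seq big1// => e eR; case: eqP => // se; rewrite se eR in sR.
rewrite (bigD1_seq s)//= eqxx big1 ?addr0// => e /negPf.
by rewrite eq_sym => ->.
Qed.

Lemma loop_elt_sum (R : seq int) (F : int -> laurent g) :
  loop_elt nu (\sum_(e <- R) F e) = \sum_(e <- R) loop_elt nu (F e).
Proof.
apply: (big_morph (loop_elt nu)) => // x y.
by rewrite -[RHS]/((x + y, 0 + 0, 0 + 0) : hat) addr0.
Qed.

Lemma affine_expand (X : V) : exists R0 : seq int,
  (forall e, e \notin R0 -> loop_coef e X = 0) /\
  forall R, uniq R -> {subset R0 <= R} ->
    X = c_part (val X) *: central + d_part (val X) *: scaling +
        \sum_(e <- R) current e (loop_coef e X).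
Proof.
have [R0 uR0 XR0] := laurent_supp (loop_part (val X)).
exists R0; split=> // R uR R0R; apply: val_inj.
rewrite val_lincomb val_sum val_scaling -[val central]/(c_elt g nu).
have -> : d_part (val X) *: (if d_elt g nu \in W then d_elt g nu else 0) =
    d_part (val X) *: d_elt g nu.
  case: ifP => // dW; have [->|d0] := eqVneq (d_part (val X)) 0; first by rewrite !scale0r.
  case/negP: (negbT dW); have := scaling_mem (valP X).
  move=> /(@rpredZ _ _ (lie_sub_mem W) (d_part (val X))^-1).
  by rewrite scalerA mulVf// scale1r.
have -> : \sum_(e <- R) val (current e (loop_coef e X)) = loop_elt nu (loop_part (val X)).
  rewrite [loop_part _ in RHS](laurent_sum uR) => [|e eR]; last first.
    by apply: XR0; apply: contra eR; exact: R0R.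
  rewrite loop_elt_sum; apply: eq_bigr => e _ /=.
  by rewrite (component_id char0 r_gt0 eta_prim (loop_coef_hom e X)).
apply: affinizationP.
- rewrite -[RHS]/(c_part (val X) *: 0 + d_part (val X) *: 0 + loop_part (val X)).
  by rewrite !scaler0 !add0r.
- by rewrite -[RHS]/(c_part (val X) * 1 + d_part (val X) * 0 + 0) mulr1 mulr0 !addr0.
- by rewrite -[RHS]/(c_part (val X) * 0 + d_part (val X) * 1 + 0) mulr1 mulr0 add0r addr0.
Qed.

Variables (S : poissonAlgType k) (i : {linear V -> S}).
Hypothesis SP : is_symmetric_poisson i.
Local Notation c := (i central).

Lemma lie_affine_c (a : S) : lie a c = 0.
Proof.
rewrite lieC; apply/eqP; rewrite oppr_eq0; apply/eqP.
have zero_der : derivation (fun _ : S => 0 : S).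
  by split=> [b u v|u v]; rewrite ?scaler0 ?mul0r ?mulr0 addr0.
apply: (derivation_eq SP.1 (lie_derivation _) zero_der) => X.
by rewrite SP.2 lieC lie_central oppr0 raddf0.
Qed.

Lemma affine_poisson_ideal_from_constants (I K : set S) : poisson_ideal I -> ideal K ->
  (forall p, saturated_radical c I (horner_alg c p) -> K (horner_alg c p)) ->
  forall u, I u -> K u.
Proof.
move=> PI idK IK u Iu.
have PJ := poisson_saturated_radical char0 lie_affine_c PI.
apply: (@poisson_ideal_from_constants k char0 g sigma r eta sigma_lie r_gt0 sigma_r eta_prim
  (aff_simple D) killing_neq0 nu V central scaling current (fun X => c_part (val X))
  (fun X => d_part (val X)) loop_coef _ current_linear _ _ loop_coef_linear _ _ _
  loop_coef_hom lie_central lie_current scaling_alt affine_expand S i SP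
  (saturated_radical c I) PJ _ _ K idK IK).
- exact: aff_nu_neq0.
- by move=> a X Y; rewrite linearP.
- by move=> a X Y; rewrite linearP.
- by [].
- by [].
- by [].
- by move=> a m; exact: saturated_radicalX.
- by move=> a; exact: saturated_radical_cancel.
- exact: (sub_saturated_radical c PI Iu).
Qed.

(** The linear form giving the coefficient of $c$ extends to a morphism from $S$
    to polynomials that maps $c$ to the indeterminate. *)
Lemma horner_alg_central_inj p : horner_alg c p = 0 -> p = 0.
Proof.
pose f (X : V) : {poly k} := c_part (val X) *: 'X.
have f_lin : linear f by move=> a X Y; rewrite /f linearP c_partP scalerDl scalerA.
pose fL : {linear V -> {poly k}} := HB.pack f
  (GRing.isSemilinear.Build k V _ _ f (GRing.semilinear_linear f_lin)).
have [h hf _] := SP.1 {poly k} fL.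
have hc : h c = 'X by have /= -> := hf central; rewrite /f /c_part /= scale1r.
by move=> /(congr1 h); rewrite lrmorph_horner_alg hc horner_alg_X rmorph0.
Qed.

(** Otherwise the saturated radical meets $\Bbbk[c]$ in zero: if $c p(c)$ has a
    power in $I$ then $p = 0$. *)
Lemma poisson_ideal_meets_constants (I : set S) : poisson_ideal I -> I <> [set 0] ->
  exists p, horner_alg c p != 0 /\ I (horner_alg c p).
Proof.
move=> PI I_neq0; apply: contrapT => noI; apply: I_neq0.
have sub0 : forall u, I u -> [set (0 : S)] u.
  apply: affine_poisson_ideal_from_constants => // [|p [m Im]].
    split=> [//|a b -> ->|a b ->]; rewrite ?addr0 ?mulr0//.
  apply: contrapT => hp; apply: noI; exists (('X * p) ^+ m).
  have E : horner_alg c (('X * p) ^+ m) = (c * horner_alg c p) ^+ m.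
    by rewrite rmorphXn rmorphM /= horner_algX.
  split; last by rewrite E.
  apply/eqP => /horner_alg_central_inj/eqP.
  rewrite expf_eq0 mulf_eq0 polyX_eq0 /= => /andP[_ /eqP p0].
  by apply: hp; rewrite p0 rmorph0.
by apply/seteqP; split=> [u /sub0//|u ->]; case: PI.
Qed.

(** Let $J$ be the preimage of a proper ideal. If $p(c)$ is in its saturated
    radical, then a power of $\lambda p(\lambda)$ is in $J$, so $p(\lambda) = 0$
    and $p(c) \in (c - \lambda)$; hence $J \subseteq (c - \lambda)$. *)
Lemma quotient_poisson_simple (lambda : k) (Q : poissonAlgType k)
  (q : {lrmorphism S -> Q}) :
  lambda != 0 -> is_poisson_quotient (c - lambda%:A) q -> poisson_simple Q.
Proof.
move=> lambda0 [q_surj q_ker q_lie] I PI; have [I0 _ IM _] := PI.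
have [I1|I1] := pselect (I 1).
  by right; apply/seteqP; split=> // u _; rewrite -[u]mulr1; exact: IM.
have qc : q c = lambda%:A.
  apply/eqP; rewrite -subr_eq0 -(rmorph_alg q) -rmorphB; apply/eqP/q_ker.
  by exists 1; rewrite mul1r.
left; have sub0 : forall u, I (q u) -> q u = 0.
  apply: (affine_poisson_ideal_from_constants (K := [set u | q u = 0])
    (poisson_ideal_preimage q_lie PI)) => [|p [m]].
    split=> [|a b /= a0 b0|a b /= b0]; rewrite /= ?rmorph0//.
      by rewrite rmorphD /= a0 b0 addr0.
    by rewrite rmorphM /= b0 mulr0.
  rewrite /= rmorphXn rmorphM /= lrmorph_horner_alg qc horner_alg_scalar.
  rewrite -scalerAl mul1r scalerA => Im.
  have [->|pl] := eqVneq p.[lambda] 0; first by rewrite scale0r.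
  case: I1; have /(idealZ_inv (poisson_ideal_ideal PI)) : I ((lambda * p.[lambda]) ^+ m *: 1).
    by rewrite -[1](expr1n _ m) -exprZn.
  by apply; rewrite expf_neq0// mulf_neq0.
apply/seteqP; split=> [u Iu|u ->//].
by have [a qa] := q_surj u; rewrite -qa in Iu *; exact: sub0.
Qed.

Lemma base_change_poisson_simple (A : poissonAlgType {fraction {poly k}})
  (phi : {rmorphism S -> A}) :
  is_poisson_base_change c phi -> poisson_simple A.
Proof.
move=> [bc phi_lie] I PI; have [I0 _ IM _] := PI.
have PJ := poisson_ideal_preimage phi_lie PI.
have [J0|J0] := pselect ([set u | I (phi u)] = [set 0]).
  left; apply/seteqP; split=> [a Ia|a ->//].
  have [p [s [p0 ps]]] := base_change_fraction bc a.
  have : [set u | I (phi u)] s by rewrite /= -ps -mulr_algl; exact: IM.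
  rewrite J0 /= => s0; move: ps; rewrite s0 rmorph0 => /eqP.
  by rewrite scaler_eq0 tofrac_eq0 (negPf p0) => /eqP.
right; have [p [p0 Ip]] := poisson_ideal_meets_constants PJ J0.
have {p0} p0 : tofrac p != 0 by rewrite tofrac_eq0; apply: contraNneq p0 => ->; rewrite rmorph0.
have I1 : I 1.
  apply: (idealZ_inv (poisson_ideal_ideal PI) p0).
  by move: Ip; rewrite /= bc.1.
by apply/seteqP; split=> // u _; rewrite -[u]mulr1; exact: IM.
Qed.

End AffineSubalgebra.

Theorem theorem6p14 (k : closedFieldType) (char0 : [pchar k] =i pred0)
  (D : affineDatum k)
  (S : poissonAlgType k) (i : {linear affine D -> S})
  (SP : is_symmetric_poisson i)
  (S' : poissonAlgType k) (i' : {linear affine' D -> S'})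
  (SP' : is_symmetric_poisson i') :
  let c := i (affine_c D) in
  let c' := i' (affine'_c D) in
  [/\ (* (1) *)
      forall lambda : k, lambda != 0 ->
        (forall (Q : poissonAlgType k) (q : {lrmorphism S -> Q}),
           is_poisson_quotient (c - lambda%:A) q -> poisson_simple Q) /\
        (forall (Q : poissonAlgType k) (q : {lrmorphism S' -> Q}),
           is_poisson_quotient (c' - lambda%:A) q -> poisson_simple Q),
      (* (2) *)
      (forall I : set S, poisson_ideal I -> I <> [set 0] ->
         exists p : {poly k}, horner_alg c p != 0 /\ I (horner_alg c p)) /\
      (forall I : set S', poisson_ideal I -> I <> [set 0] ->
         exists p : {poly k}, horner_alg c' p != 0 /\ I (horner_alg c' p))
    & (* (2), equivalent form *)
      (forall (A : poissonAlgType {fraction {poly k}})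
          (phi : {rmorphism S -> A}),
         is_poisson_base_change c phi -> poisson_simple A) /\
      (forall (A : poissonAlgType {fraction {poly k}})
          (phi : {rmorphism S' -> A}),
         is_poisson_base_change c' phi -> poisson_simple A)].
Proof.
move=> c c'.
have affW X : X \in affine_sub D -> X \in @affine_pred k D by [].
have Waff X : X \in @affine'_pred k D -> X \in affine_sub D.
  by rewrite affine'_predE => /andP[].
have affW' X : X \in affine'_sub D -> X \in @affine_pred k D.
  by rewrite affine'_predE => /andP[].
have Waff' X : X \in @affine'_pred k D -> X \in affine'_sub D by [].
split=> [lambda lambda0||]; split.
- move=> Q q; exact: (quotient_poisson_simple char0 affW Waff SP lambda0).
- move=> Q q; exact: (quotient_poisson_simple char0 affW' Waff' SP' lambda0).
- exact: (poisson_ideal_meets_constants char0 affW Waff (affine_c_subproof D) SP).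
- exact: (poisson_ideal_meets_constants char0 affW' Waff' (affine'_c_subproof D) SP').
- exact: (base_change_poisson_simple char0 affW Waff SP).
- exact: (base_change_poisson_simple char0 affW' Waff' SP').
Qed.
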